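(* Consider the variance reduced SQP algorithm described in the context with the constant step size $\bar\alpha_{k,s}=\alpha$, under all standing assumptions listed there (including the merit parameter assumption with $\bar k_\tau$, $\bar\tau_{\min}$). Let $\gamma\in(0,1]$ and $b<N^{\gamma}$. There exist universal constants $\mu_0\in(0,1]$ and $\nu_0\in(0,1)$ such that the following holds. Suppose $$\alpha=\frac{\mu_0 b}{(\bar\tau_{\min}L+\Gamma)N^{\gamma}}\in(0,1],\qquad z=\frac{\bar\tau_{\min}L+\Gamma}{N^{\gamma/2}},\qquad S\le\left\lfloor \frac{N^{3\gamma/2}}{\mu_0\left(b+\frac{L^2}{(\bar\tau_{\min}L+\Gamma)^2\kappa_l\zeta}\right)}\right\rfloor .$$ Define $\lambda_S=0$ and, for $s\in\{0,\dots,S-1\}$, $$\lambda_s=\lambda_{s+1}\left(\frac{\alpha^2L^2}{\kappa_l b\zeta}+\alpha z+1\right)+\frac{\alpha^2(\bar\tau_{\min}L+\Gamma)L^2}{2\kappa_l b\zeta},\qquad \Lambda_s=\alpha-\frac{\alpha^2(\bar\tau_{\min}L+\Gamma)}{2\bar\tau_{\min}\kappa_l}-\lambda_{s+1}\frac{\alpha}{\bar\tau_{\min}\kappa_l}\left(\alpha+\frac1z\right),$$ and $\Lambda_{\min}=\min_{0\le s\le S-1}\Lambda_s$. Then $\Lambda_{\min}\ge\frac{\nu_0 b}{(\bar\tau_{\min}L+\Gamma)N^{\gamma}}$ and, for all $k\ge\bar k_\tau$, $$\mathbb{E}_{\tau_{\min}}\left[\frac{1}{(k-\bar k_\tau+1)S}\sum_{j=\bar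 k_\tau}^{k}\sum_{s=0}^{S-1}\left(\frac{\|g_{j,s}+J_{j,s}^Ty_{j,s}\|_2^2}{\kappa_H^2}+\|c_{j,s}\|_2\right)\right]\le\frac{(\bar\tau_{\min}L+\Gamma)N^{\gamma}\left(\mathbb{E}_{\tau_{\min}}[\phi(x_{\bar k_\tau,0},\bar\tau_{\min})]-\phi_{\inf}\right)}{(k-\bar k_\tau+1)S\nu_0 b}.$$ Moreover, if for some $(k,s)\in\mathbb{N}\times\{0,\dots,S-1\}$ one has $\|x_{k,s}-x^*\|_2\le\delta_x$, $\|x_{k,0}-x^*\|_2\le\delta_{x,0}$ and $\|c_{k,s}\|_2\le\delta_c$, for some $\delta_x,\delta_{x,0},\delta_c>0$ and some stationary point $(x^*,y^* )\in\mathbb{R}^n\times\mathbb{R}^m$ of the problem (i.e. $\nabla f(x^* )+\nabla c(x^* )y^*=0$ and $c(x^* )=0$), then $$\mathbb{E}_{k,s}\left[\left\|\begin{bmatrix}\bar g_{k,s}-\nabla f(x^* )\\ c_{k,s}\end{bmatrix}\right\|_2\right]\le\delta_y\quad\text{and}\quad\mathbb{E}_{k,s}\left[\|\bar y_{k,s}-y_{k,s}\|_2\right]\le\kappa_d\delta_y+2\kappa_d^2\Gamma\delta_x\|\nabla f(x^* )\|_2,$$ where $\delta_y=\delta_c+L(\delta_{x,0}+\delta_x)/\sqrt b+L\delta_x$ and $\kappa_d>0$ is an upper bound for $\left\|\begin{bmatrix}H_{k,s}&J_{k,s}^T\\ J_{k,s}&0\end{bmatrix}^{-1}\right\|_2$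.
   Context: Problem: $\min_{x\in\mathbb{R}^n} f(x)$ s.t. $c(x)=0$, with $f=\frac1N\sum_{i=1}^N f_i$, $f_i:\mathbb{R}^n\to\mathbb{R}$, $c:\mathbb{R}^n\to\mathbb{R}^m$. Indices: $k\in\mathbb{N}=\{0,1,\dots\}$ (outer), $s\in\{0,\dots,S-1\}$ (inner). Write $g=\nabla f$, $J=\nabla c^T$ ($m\times n$ Jacobian), and $f_{k,s}=f(x_{k,s})$, $g_{k,s}=\nabla f(x_{k,s})$, $c_{k,s}=c(x_{k,s})$, $J_{k,s}=J(x_{k,s})$. Smoothness assumption: $\mathcal X\subseteq\mathbb{R}^n$ is an open convex set containing all iterates $x_{k,s}$ of any run. $f$ and $\nabla f$ are bounded over $\mathcal X$; each $f_i$ is continuously differentiable with $L$-Lipschitz gradient; each $c_i$ is continuously differentiable and bounded over $\mathcal X$, with $\gamma_i$-Lipschitz gradient, $\gamma_i>0$, and $\Gamma:=\sum_{i=1}^m\gamma_i$; $J$ is bounded over $\mathcal X$ with singular values bounded away from zero over $\mathcal X$. Matrices: $H_{k,s}\in\mathbb{R}^{n\times n}$ are symmetric, the sequence $\{H_{k,s}\}$ is independent of $\{\bar g_{k,s}\}$ and bounded in norm by $\kappa_H>0$, and there is $\zeta>0$ with $u^TH_{k,s}u\ge\zeta\|u\|_2^2$ whenever $J_{k,s}u=0$. Gradient estimates: with a random mini-batch $I_{k,s}\subset\{1,\dots,N\}$ of size $b\in\{1,\dots,N-1\}$, $\tilde g_{k,s}=\frac1b\sum_{i\in I_{k,s}}\nabla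 f_i(x_{k,s})$ and $\bar g_{k,s}=\frac1b\sum_{i\in I_{k,s}}\left(\nabla f_i(x_{k,s})-(\nabla f_i(x_{k,0})-\nabla f(x_{k,0}))\right)$. $\mathbb{E}_{k,s}$ is expectation conditioned on the algorithm having reached $x_{k,0}$ and $x_{k,s}$ (and, where the merit parameter assumption below is in force, also on the event $E_{\tau_{\min}}$). Assumed: $\mathbb{E}_{k,s}[\tilde g_{k,s}]=g_{k,s}$, hence $\mathbb{E}_{k,s}[\bar g_{k,s}]=g_{k,s}$, and $\mathbb{E}_{k,s}[\|\bar g_{k,s}-g_{k,s}\|_2^2]\le M_{k,s}:=\frac{L^2}{b}\|x_{k,s}-x_{k,0}\|_2^2$. Merit function: $\phi(x,\tau)=\tau f(x)+\|c(x)\|_1$. For $d$ with $c(x)+\nabla c(x)^Td=0$: $\Delta l(x,\tau,g,d)=-\tau g^Td+\|c(x)\|_1$. Algorithm: inputs $x_{-1,S}$, $\bar\tau_{-1,S-1}>0$, $\epsilon_\tau,\sigma\in(0,1)$, $b$, $S\ge1$. For each $k$: $x_{k,0}=x_{k-1,S}$, $\bar\tau_{k,-1}=\bar\tau_{k-1,S-1}$. For each $s$: form $\bar g_{k,s}$ and solve $\begin{bmatrix}H_{k,s}&J_{k,s}^T\\ J_{k,s}&0\end{bmatrix}\begin{bmatrix}\bar d_{k,s}\\ \bar y_{k,s}\end{bmatrix}=-\begin{bmatrix}\bar g_{k,s}\\ c_{k,s}\end{bmatrix}$. If $\bar d_{k,s}=0$, set $x_{k,s+1}=x_{k,s}$,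 $\bar\tau_{k,s}=\bar\tau_{k,s-1}$ and go to the next inner iteration. Otherwise let $q=\bar g_{k,s}^T\bar d_{k,s}+\max\{\bar d_{k,s}^TH_{k,s}\bar d_{k,s},0\}$; set $\bar\tau^{trial}_{k,s}=\infty$ if $q\le0$ and $\bar\tau^{trial}_{k,s}=(1-\sigma)\|c_{k,s}\|_1/q$ otherwise; set $\bar\tau_{k,s}=\bar\tau_{k,s-1}$ if $\bar\tau_{k,s-1}\le\bar\tau^{trial}_{k,s}$ and $\bar\tau_{k,s}=(1-\epsilon_\tau)\bar\tau^{trial}_{k,s}$ otherwise. Choose the step size $\bar\alpha_{k,s}$ and set $x_{k,s+1}=x_{k,s}+\bar\alpha_{k,s}\bar d_{k,s}$. Constant step size option: $\bar\alpha_{k,s}=\alpha\in(0,1]$. Deterministic counterparts: $(d_{k,s},y_{k,s})$ solves the same linear system with $\bar g_{k,s}$ replaced by $g_{k,s}$; $\tau^{trial}_{k,s}$ is defined like $\bar\tau^{trial}_{k,s}$ with $(\bar g_{k,s},\bar d_{k,s})$ replaced by $(g_{k,s},d_{k,s})$. Merit parameter assumption: the event $E_{\tau_{\min}}$ occurs that there exist $\bar k_\tau\in\mathbb{N}$ and $\bar\tau_{\min}>0$ with $\bar\tau_{k,s}=\bar\tau_{\min}\le\tau^{trial}_{k,s}$ for all $k\ge\bar k_\tau$ and all $s\in\{0,\dots,S-1\}$; moreover the unbiasedness above holds conditionally on $E_{\tau_{\min}}$. $\mathbb{E}_{\tau_{\min}}$ denotes total expectation conditioned on this assumption. $\phi_{\inf}:=\inf_{x\in\mathcal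 X}\phi(x,\bar\tau_{\min})>-\infty$. $\kappa_l>0$ is a constant (it exists by a preliminary lemma of the paper) such that $\Delta l(x_{k,s},\bar\tau_{k,s},g_{k,s},d_{k,s})\ge\kappa_l\bar\tau_{k,s}\|d_{k,s}\|_2^2$ and $\Delta l(x_{k,s},\bar\tau_{k,s},\bar g_{k,s},\bar d_{k,s})\ge\kappa_l\bar\tau_{k,s}\|\bar d_{k,s}\|_2^2$ for all $(k,s)$. ''Universal'' constants are independent of $N$, $k$ and $s$; they may depend on the fixed constants $L,\Gamma,\bar\tau_{\min},\kappa_l,\kappa_H,\zeta,\sigma$ and on $b$. *)

(* Defs.v *)
From HB Require Import structures.
From mathcomp Require Import all_boot all_order all_algebra.
From mathcomp Require Import all_classical all_reals all_analysis.
Set Implicit Arguments.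
Unset Strict Implicit.
Unset Printing Implicit Defensive.
Import Order.TTheory GRing.Theory Num.Theory.
Import numFieldNormedType.Exports.
Local Open Scope classical_set_scope.
Local Open Scope ring_scope.

Section Norms.
Context {R : realType}.

Definition dotv n (u v : 'cV[R]_n) : R := \sum_(i < n) u i 0 * v i 0.

(* The library norm on matrices is the max norm; it is used here only through
   the topology it induces (differentiability, continuity, openness). *)
Definition l2norm n (v : 'cV[R]_n) : R := Num.sqrt (\sum_(i < n) v i 0 ^+ 2).
Definition l1norm n (v : 'cV[R]_n) : R := \sum_(i < n) `|v i 0|.
Definition opnorm2 p q (A : 'M[R]_(p, q)) : R :=
  sup [set l2norm (A *m v) | v in [set v : 'cV[R]_q | l2norm v <= 1]].

(* The p singular values of a p x q matrix with p <= q.  When p > q the value 0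
   is included, so that "bounded away from 0" entails full row rank. *)
Definition singular_value p q (A : 'M[R]_(p, q)) (s : R) : Prop :=
  0 <= s /\ eigenvalue (A *m A^T) (s ^+ 2).

End Norms.

Section Problem.
Context {R : realType}.

Definition grad n (h : 'cV[R]_n -> R) (x : 'cV[R]_n) : 'cV[R]_n :=
  \col_(j < n) 'D_(delta_mx j 0) h x.

Definition constr n m (c : 'cV[R]_n -> 'cV[R]_m) (i : 'I_m) : 'cV[R]_n -> R :=
  fun x => c x i 0.

Definition jac n m (c : 'cV[R]_n -> 'cV[R]_m) (x : 'cV[R]_n) : 'M[R]_(m, n) :=
  \matrix_(i < m, j < n) grad (constr c i) x j 0.

Definition favg n N (f : 'I_N -> 'cV[R]_n -> R) (x : 'cV[R]_n) : R :=
  N%:R^-1 * \sum_(i < N) f i x.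

Definition C1 n (h : 'cV[R]_n -> R) : Prop :=
  (forall x, differentiable h x) /\ continuous (grad h).

Definition lipschitz_grad n (L : R) (h : 'cV[R]_n -> R) : Prop :=
  forall x y, l2norm (grad h x - grad h y) <= L * l2norm (x - y).

Definition bounded_over (U V : Type) (nrm : V -> R) (X : set U) (h : U -> V) :
  Prop := exists M : R, forall x, X x -> nrm (h x) <= M.

Record smooth_problem n m N (X : set 'cV[R]_n) (f : 'I_N -> 'cV[R]_n -> R)
    (c : 'cV[R]_n -> 'cV[R]_m) (L : R) (gam : 'I_m -> R) : Prop := {
  X_open : open X;
  X_convex : convex_set (X : set (convex_lmodType 'cV[R]_n));
  f_bounded : bounded_over Num.norm X (favg f);
  gradf_bounded : bounded_over (@l2norm R n) X (grad (favg f));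
  f_C1 : forall i, C1 (f i);
  f_lip : forall i, lipschitz_grad L (f i);
  c_C1 : forall i, C1 (constr c i);
  c_bounded : forall i, bounded_over Num.norm X (constr c i);
  gam_gt0 : forall i, 0 < gam i;
  c_lip : forall i, lipschitz_grad (gam i) (constr c i);
  J_bounded : bounded_over (@opnorm2 R m n) X (jac c);
  J_singular : exists2 kJ : R, 0 < kJ &
    forall x s, X x -> singular_value (jac c x) s -> kJ <= s }.

Definition merit n m N (f : 'I_N -> 'cV[R]_n -> R) (c : 'cV[R]_n -> 'cV[R]_m)
  (x : 'cV[R]_n) (tau : R) : R := tau * favg f x + l1norm (c x).

(* [cx] stands for the value c(x). *)
Definition model_reduction n m (cx : 'cV[R]_m) (tau : R) (g d : 'cV[R]_n) : R :=
  - tau * dotv g d + l1norm cx.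

Definition stationary n m N (f : 'I_N -> 'cV[R]_n -> R)
    (c : 'cV[R]_n -> 'cV[R]_m) (x : 'cV[R]_n) (y : 'cV[R]_m) : Prop :=
  grad (favg f) x + (jac c x)^T *m y = 0 /\ c x = 0.

Definition kkt_mx n m (H : 'M[R]_n) (J : 'M[R]_(m, n)) : 'M[R]_(n + m) :=
  block_mx H J^T J 0.

Definition trial_denominator n (H : 'M[R]_n) (g d : 'cV[R]_n) : R :=
  dotv g d + Num.max (dotv d (H *m d)) 0.

Definition tau_trial n m (sigma : R) (H : 'M[R]_n) (cx : 'cV[R]_m)
    (g d : 'cV[R]_n) : \bar R :=
  if trial_denominator H g d <= 0 then +oo%E
  else ((1 - sigma) * l1norm cx / trial_denominator H g d)%:E.

Definition tau_update (eps tau : R) (trial : \bar R) : R :=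
  if (tau%:E <= trial)%E then tau else (1 - eps) * fine trial.

End Problem.

Section CondExp.
Context d {T : measurableType d} {R : realType}.

(* sigma-algebra generated by the entries of a random matrix *)
Definition sigma_mx p q (Y : T -> 'M[R]_(p, q)) : set (set T) :=
  <<s [set A | exists i j (B : set R),
         measurable B /\ A = (fun w => Y w i j) @^-1` B] >>.

Definition random_mx p q (Y : T -> 'M[R]_(p, q)) : Prop :=
  forall i j, measurable_fun setT (fun w => Y w i j).

(* P(. | E), when P E > 0 *)
Definition cond_prob (P : probability T R) (E : set T) (mE : measurable E) :
  probability T R := mnormalize (mrestr P mE) P.

(* V is a version of the conditional expectation of Y given the
   sub-sigma-algebra G *)
Definition is_condexp (Q : probability T R) (G : set (set T)) (Y V : T -> R) :
  Prop :=
  [/\ Q.-integrable setT (EFin \o Y),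
      forall B : set R, measurable B -> G (V @^-1` B),
      Q.-integrable setT (EFin \o V) &
      forall A, G A -> (\int[Q]_(w in A) (V w)%:E = \int[Q]_(w in A) (Y w)%:E)%E].

(* entrywise, for random vectors *)
Definition is_condexp_mx (Q : probability T R) (G : set (set T)) p q
    (Y V : T -> 'M[R]_(p, q)) : Prop :=
  forall i j, is_condexp Q G (fun w => Y w i j) (fun w => V w i j).

(* E[Y | G] <= B almost surely on the event D *)
Definition condexp_le_on (Q : probability T R) (G : set (set T)) (D : set T)
    (Y B : T -> R) : Prop :=
  exists V, is_condexp Q G Y V /\ {ae Q, forall w, D w -> V w <= B w}.

(* conditional independence given G: Q(A /\ B | G) = Q(A | G) Q(B | G) *)
Definition cond_independent (Q : probability T R) (G F1 F2 : set (set T)) :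
  Prop :=
  forall A B, F1 A -> F2 B -> exists u v : T -> R,
    [/\ is_condexp Q G (\1_A : T -> R) u, is_condexp Q G (\1_B : T -> R) v &
        is_condexp Q G (\1_(A `&` B) : T -> R) (fun w => u w * v w)].

End CondExp.

(* Random quantities of a run of the algorithm; the arguments of every field are
   the outer index k, the inner index s and the outcome. *)
Record sqp_process (R : realType) (T : Type) (n m N : nat) := SqpProcess {
  itr : nat -> nat -> T -> 'cV[R]_n;          (* x_{k,s}, 0 <= s <= S *)
  batch : nat -> nat -> T -> {set 'I_N};      (* I_{k,s} *)
  hess : nat -> nat -> T -> 'M[R]_n;          (* H_{k,s} *)
  dbar : nat -> nat -> T -> 'cV[R]_n;
  ybar : nat -> nat -> T -> 'cV[R]_m;
  taubar : nat -> nat -> T -> R;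
  dtrue : nat -> nat -> T -> 'cV[R]_n;        (* d_{k,s} *)
  ytrue : nat -> nat -> T -> 'cV[R]_m }.      (* y_{k,s} *)

Section Algorithm.
Context {R : realType} {d : measure_display} {T : measurableType d}.
Context {n m N : nat}.
Variables (f : 'I_N -> 'cV[R]_n -> R) (c : 'cV[R]_n -> 'cV[R]_m).
Variables (b S : nat) (p : sqp_process R T n m N).

Definition g_at k s (w : T) : 'cV[R]_n := grad (favg f) (itr p k s w).
Definition c_at k s (w : T) : 'cV[R]_m := c (itr p k s w).
Definition J_at k s (w : T) : 'M[R]_(m, n) := jac c (itr p k s w).
Definition K_at k s (w : T) : 'M[R]_(n + m) :=
  kkt_mx (hess p k s w) (J_at k s w).

Definition gtilde k s (w : T) : 'cV[R]_n :=
  b%:R^-1 *: \sum_(i in batch p k s w) grad (f i) (itr p k s w).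

Definition gbar k s (w : T) : 'cV[R]_n :=
  b%:R^-1 *: \sum_(i in batch p k s w)
    (grad (f i) (itr p k s w) -
       (grad (f i) (itr p k 0%N w) - grad (favg f) (itr p k 0%N w))).

(* \bar tau_{k,s-1}, with \bar tau_{k,-1} = \bar tau_{k-1,S-1} and
   \bar tau_{-1,S-1} = tau0 *)
Definition tau_prev (tau0 : R) k s (w : T) : R :=
  if s is s'.+1 then taubar p k s' w
  else if k is k'.+1 then taubar p k' S.-1 w else tau0.

Record sqp_run (x0 : 'cV[R]_n) (tau0 eps sigma alpha : R) : Prop := {
  run_init : forall w, itr p 0 0 w = x0;
  run_outer : forall k w, itr p k.+1 0 w = itr p k S w;
  run_batch : forall k s w, (s < S)%N -> #|batch p k s w| = b;
  run_solve : forall k s w, (s < S)%N ->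
    K_at k s w *m col_mx (dbar p k s w) (ybar p k s w) =
      - col_mx (gbar k s w) (c_at k s w);
  run_null : forall k s w, (s < S)%N -> dbar p k s w = 0 ->
    itr p k s.+1 w = itr p k s w /\ taubar p k s w = tau_prev tau0 k s w;
  run_step : forall k s w, (s < S)%N -> dbar p k s w != 0 ->
    itr p k s.+1 w = itr p k s w + alpha *: dbar p k s w /\
    taubar p k s w = tau_update eps (tau_prev tau0 k s w)
      (tau_trial sigma (hess p k s w) (c_at k s w)
         (gbar k s w) (dbar p k s w)) }.

Definition deterministic_counterpart : Prop :=
  forall k s w, (s < S)%N ->
    K_at k s w *m col_mx (dtrue p k s w) (ytrue p k s w) =
      - col_mx (g_at k s w) (c_at k s w).

Record random_process : Prop := {
  itr_meas : forall k s, (s <= S)%N -> random_mx (itr p k s);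
  batch_meas : forall k s B, (s < S)%N -> measurable (batch p k s @^-1` [set B]);
  hess_meas : forall k s, (s < S)%N -> random_mx (hess p k s);
  dbar_meas : forall k s, (s < S)%N -> random_mx (dbar p k s);
  ybar_meas : forall k s, (s < S)%N -> random_mx (ybar p k s);
  taubar_meas : forall k s, (s < S)%N -> measurable_fun setT (taubar p k s);
  dtrue_meas : forall k s, (s < S)%N -> random_mx (dtrue p k s);
  ytrue_meas : forall k s, (s < S)%N -> random_mx (ytrue p k s) }.

Record hess_assumption (kH zeta : R) : Prop := {
  hess_sym : forall k s w, (s < S)%N -> (hess p k s w)^T = hess p k s w;
  hess_bounded : forall k s w, (s < S)%N -> opnorm2 (hess p k s w) <= kH;
  hess_curv : forall k s w u, (s < S)%N -> J_at k s w *m u = 0 ->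
    zeta * l2norm u ^+ 2 <= dotv u (hess p k s w *m u) }.

Definition merit_event (sigma : R) (kbar : nat) (taumin : R) : set T :=
  [set w | forall k s, (kbar <= k)%N -> (s < S)%N ->
     taubar p k s w = taumin /\
     (taumin%:E <= tau_trial sigma (hess p k s w) (c_at k s w)
                     (g_at k s w) (dtrue p k s w))%E].

(* sigma-algebra of the conditioning E_{k,s} on (x_{k,0}, x_{k,s}) *)
Definition sigma_ks k s : set (set T) :=
  sigma_mx (fun w => col_mx (itr p k 0%N w) (itr p k s w)).

(* [Q] is the underlying probability conditioned on the merit parameter event.
   That {H_{k,s}} is independent of {\bar g_{k,s}} means, since both depend on
   the past of the run, independence given (x_{k,0}, x_{k,s}). *)
Record gradient_estimates (Q : probability T R) (L : R) : Prop := {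
  gtilde_unbiased : forall k s, (s < S)%N ->
    is_condexp_mx Q (sigma_ks k s) (gtilde k s) (g_at k s);
  gbar_unbiased : forall k s, (s < S)%N ->
    is_condexp_mx Q (sigma_ks k s) (gbar k s) (g_at k s);
  gbar_variance : forall k s, (s < S)%N ->
    condexp_le_on Q (sigma_ks k s) setT
      (fun w => l2norm (gbar k s w - g_at k s w) ^+ 2)
      (fun w => L ^+ 2 / b%:R * l2norm (itr p k s w - itr p k 0%N w) ^+ 2);
  hess_indep : forall k s, (s < S)%N ->
    cond_independent Q (sigma_ks k s)
      (sigma_mx (hess p k s)) (sigma_mx (gbar k s)) }.

Definition model_reduction_bound (E : set T) (kl : R) : Prop :=
  forall k s w, (s < S)%N -> E w ->
    kl * taubar p k s w * l2norm (dtrue p k s w) ^+ 2 <=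
      model_reduction (c_at k s w) (taubar p k s w) (g_at k s w)
        (dtrue p k s w) /\
    kl * taubar p k s w * l2norm (dbar p k s w) ^+ 2 <=
      model_reduction (c_at k s w) (taubar p k s w) (gbar k s w)
        (dbar p k s w).

End Algorithm.

(* Main.v *)
Require Import Defs.
From HB Require Import structures.
From mathcomp Require Import all_boot all_order all_algebra.
From mathcomp Require Import all_classical all_reals all_analysis.
From mathcomp Require Import measurable_realfun ring lra.
Set Implicit Arguments.
Unset Strict Implicit.
Unset Printing Implicit Defensive.
Import Order.TTheory GRing.Theory Num.Theory.
Import numFieldNormedType.Exports.
Local Open Scope classical_set_scope.
Local Open Scope ring_scope.

(** With [d_err = dbar - dtrue], each inner step decreases the merit function up
    to the terms [alpha tau g.d_err] and [alpha^2 A |dbar|^2 / 2].  Independence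
    of the Hessian and of the gradient estimate, given the iterates, makes every
    cross term linear in [gbar - g] vanish in mean, and the model reduction
    bound turns [E |dbar|^2] into model reduction plus variance.  The variance is
    proportional to [|x_{k,s} - x_{k,0}|^2], so the potential
    [E phi(x_{k,s}) + lambda_s E |x_{k,s} - x_{k,0}|^2] decreases by
    [Lambda_s E Delta l] and telescopes, [lambda_S] being [0].  The bound on [S]
    keeps the growth factor [(1 + rho)^S] of [lambda] below [e]. *)

(** * Euclidean norms and the KKT system *)

(** The cross terms shape the proof. [d_err] is the image of [- g_err] under the leading block of
    the inverse KKT matrix, and that matrix contains the Hessian, which need not be a function of
    (x_{k,0}, x_{k,s}). Unbiasedness given the iterates alone therefore does not kill the cross
    terms: [g_err] must be orthogonal to every bounded function of Hessian and iterates jointly,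
    which is drawn from conditional independence by a pi-lambda argument. Splitting a mean also
    requires integrability. It comes from boundedness on the merit event, propagated along an epoch:
    a bounded deviation bounds [gbar] whatever the batch, hence [dbar] (the model reduction grows at
    least quadratically and at most linearly in the direction), hence the next deviation. Constants:
    mu_0 is small enough that the corrections in Lambda_s cost at most half of alpha. Passing from
    the model reduction to the stationarity residual costs a factor C = 1/(kl taumin) + 1/sigma,
    whence nu_0 = (mu_0 / 2) / (1 + C). The multiplier estimate rests on the stochastic and
    deterministic systems sharing one matrix, so that their difference sees only [g_err]. *)

Section Euclid.
Context {R : realType} {n : nat}.
Implicit Types u v w : 'cV[R]_n.

Lemma dotvC u v : dotv u v = dotv v u.
Proof. by apply: eq_bigr => i _; rewrite mulrC. Qed.

Lemma dotvDl u v w : dotv (u + v) w = dotv u w + dotv v w.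
Proof. by rewrite -big_split; apply: eq_bigr => i _; rewrite mxE mulrDl. Qed.

Lemma dotvDr u v w : dotv u (v + w) = dotv u v + dotv u w.
Proof. by rewrite dotvC dotvDl !(dotvC u). Qed.

Lemma dotvZl a u v : dotv (a *: u) v = a * dotv u v.
Proof. by rewrite mulr_sumr; apply: eq_bigr => i _; rewrite mxE mulrA. Qed.

Lemma dotvZr a u v : dotv u (a *: v) = a * dotv u v.
Proof. by rewrite dotvC dotvZl dotvC. Qed.

Lemma dotvNl u v : dotv (- u) v = - dotv u v.
Proof. by rewrite -scaleN1r dotvZl mulN1r. Qed.

Lemma dotvNr u v : dotv u (- v) = - dotv u v.
Proof. by rewrite dotvC dotvNl dotvC. Qed.

Lemma dotvBl u v w : dotv (u - v) w = dotv u w - dotv v w.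
Proof. by rewrite dotvDl dotvNl. Qed.

Lemma dotv0r u : dotv u 0 = 0.
Proof. by rewrite -(scale0r 0) dotvZr mul0r. Qed.

Lemma l2norm_ge0 u : 0 <= l2norm u. Proof. exact: sqrtr_ge0. Qed.

Lemma sqr_l2norm u : l2norm u ^+ 2 = dotv u u.
Proof. by rewrite sqr_sqrtr ?sumr_ge0// => i _; rewrite sqr_ge0. Qed.

Lemma dotvv_ge0 u : 0 <= dotv u u.
Proof. by rewrite -sqr_l2norm sqr_ge0. Qed.

Lemma l2norm0 : l2norm (0 : 'cV[R]_n) = 0.
Proof. by apply/eqP; rewrite -sqrf_eq0 sqr_l2norm dotv0r. Qed.

Lemma l2norm_eq0 u : l2norm u = 0 -> u = 0.
Proof.
move=> /(congr1 (fun x => x ^+ 2)); rewrite sqr_l2norm expr0n /= => /eqP.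
rewrite psumr_eq0 => [/allP h|i _]; last by rewrite -expr2 sqr_ge0.
apply/colP => i; rewrite mxE; apply/eqP.
by have := h i (mem_index_enum i); rewrite /= mulf_eq0 orbb.
Qed.

Lemma dotv_le u v : dotv u v <= l2norm u * l2norm v.
Proof.
have [v0|v0] := eqVneq (l2norm v) 0.
  by rewrite (l2norm_eq0 v0) dotv0r l2norm0 mulr0.
have [u0|u0] := eqVneq (l2norm u) 0.
  by rewrite (l2norm_eq0 u0) dotvC dotv0r l2norm0 mul0r.
have pu : 0 < l2norm u by rewrite lt_def u0 l2norm_ge0.
have pv : 0 < l2norm v by rewrite lt_def v0 l2norm_ge0.
have := dotvv_ge0 (l2norm v *: u - l2norm u *: v).
rewrite !(dotvDl, dotvDr, dotvNl, dotvNr, dotvZl, dotvZr) -!sqr_l2norm (dotvC v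
  u).
set a := l2norm u in pu *; set c := l2norm v in pv *; set x := dotv u v.
move=> h; have {h} : 0 <= 2 * (a * c) * (a * c - x).
  by apply: le_trans h _; rewrite le_eqVlt; apply/orP; left; apply/eqP; ring.
by rewrite pmulr_rge0 ?subr_ge0// mulr_gt0// mulr_gt0.
Qed.

Lemma norm_dotv_le u v : `|dotv u v| <= l2norm u * l2norm v.
Proof.
rewrite ler_norml dotv_le andbT lerNl -dotvNl.
by rewrite (le_trans (dotv_le _ _))// /l2norm; under eq_bigr do rewrite mxE
  sqrrN.
Qed.

Lemma l2normN u : l2norm (- u) = l2norm u.
Proof. by rewrite /l2norm; under eq_bigr do rewrite mxE sqrrN. Qed.

Lemma l2normZ a u : l2norm (a *: u) = `|a| * l2norm u.
Proof.
rewrite /l2norm; under eq_bigr do rewrite mxE exprMn.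
by rewrite -mulr_sumr sqrtrM ?sqr_ge0// sqrtr_sqr.
Qed.

Lemma l2normD u v : l2norm (u + v) <= l2norm u + l2norm v.
Proof.
rewrite -(@ler_pXn2r _ 2)// ?nnegrE ?addr_ge0 ?l2norm_ge0//.
rewrite sqrrD !sqr_l2norm dotvDl !dotvDr (dotvC v u).
by have := dotv_le u v; lra.
Qed.

Lemma l2norm_sum (I : Type) (r : seq I) (P : pred I) (F : I -> 'cV[R]_n) :
  l2norm (\sum_(i <- r | P i) F i) <= \sum_(i <- r | P i) l2norm (F i).
Proof.
elim/big_rec2: _ => [|i x y _ le]; first by rewrite l2norm0.
by rewrite (le_trans (l2normD _ _))// lerD2l.
Qed.

Lemma coord_le_l2norm u i : `|u i 0| <= l2norm u.
Proof.
rewrite -sqrtr_sqr ler_wsqrtr// (bigD1 i)//= lerDl sumr_ge0// => j _.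
by rewrite sqr_ge0.
Qed.

Lemma l2norm_le_l1norm u : l2norm u <= l1norm u.
Proof.
have h : u = \sum_i u i 0 *: delta_mx i 0.
  apply/colP => j; rewrite summxE (bigD1 j)//= big1 => [|i ij].
    by rewrite !mxE !eqxx mulr1 addr0.
  by rewrite !mxE eq_sym (negbTE ij) mulr0.
rewrite {1}h (le_trans (l2norm_sum _ _ _))// ler_sum// => i _.
rewrite l2normZ ler_piMr// /l2norm (bigD1 i)//= big1 => [|j ji].
  by rewrite mxE !eqxx expr1n addr0 sqrtr1.
by rewrite mxE (negbTE ji) expr0n.
Qed.

Lemma l1norm_ge0 u : 0 <= l1norm u.
Proof. by apply: sumr_ge0. Qed.

End Euclid.

Lemma dotvE (R : realType) n (u v : 'cV[R]_n) : dotv u v = (u^T *m v) 0 0.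
Proof. by rewrite mxE; apply: eq_bigr => i _; rewrite mxE. Qed.

Lemma dotv_mulmx (R : realType) p q (A : 'M[R]_(p, q)) u v :
  dotv (A *m u) v = dotv u (A^T *m v).
Proof. by rewrite !dotvE trmx_mul mulmxA. Qed.

Lemma sqr_l2norm_col_mx (R : realType) p q (u : 'cV[R]_p) (v : 'cV[R]_q) :
  l2norm (col_mx u v) ^+ 2 = l2norm u ^+ 2 + l2norm v ^+ 2.
Proof.
rewrite !sqr_l2norm /dotv big_split_ord; congr (_ + _);
by apply: eq_bigr => i _; rewrite ?(col_mxEu, col_mxEd).
Qed.

Lemma l2norm_col_mx_le (R : realType) p q (u : 'cV[R]_p) (v : 'cV[R]_q) :
  l2norm (col_mx u v) <= l2norm u + l2norm v.
Proof.
rewrite -(@ler_pXn2r _ 2)// ?nnegrE ?addr_ge0 ?l2norm_ge0// sqr_l2norm_col_mx.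
by rewrite sqrrD; have := mulr_ge0 (l2norm_ge0 u) (l2norm_ge0 v); lra.
Qed.

Section OpNorm.
Context {R : realType} {p q : nat}.
Variable A : 'M[R]_(p, q).

(** A crude constant is enough: the purpose is that the set whose [sup] defines [opnorm2 A] has an
    upper bound, without which [sup] would be a default value. *)
Lemma l2norm_mulmx_le_entries (v : 'cV[R]_q) :
  l2norm (A *m v) <= (\sum_i \sum_j `|A i j|) * l2norm v.
Proof.
rewrite (le_trans (l2norm_le_l1norm _))// mulr_suml ler_sum// => i _.
rewrite mxE (le_trans (ler_norm_sum _ _ _))// mulr_suml ler_sum// => j _.
by rewrite normrM ler_wpM2l// coord_le_l2norm.
Qed.

Lemma opnorm2P (v : 'cV[R]_q) : l2norm (A *m v) <= opnorm2 A * l2norm v.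
Proof.
have [v0|v0] := eqVneq (l2norm v) 0.
  by rewrite (l2norm_eq0 v0) mulmx0 !l2norm0 mulr0.
have pv : 0 < l2norm v by rewrite lt_def v0 l2norm_ge0.
rewrite -ler_pdivrMr// /opnorm2; apply: ub_le_sup.
  exists (\sum_i \sum_j `|A i j|) => _ [w /= w1 <-].
  rewrite (le_trans (l2norm_mulmx_le_entries _))// ler_piMr//.
  by apply: sumr_ge0 => i _; apply: sumr_ge0.
exists ((l2norm v)^-1 *: v) => /=.
  by rewrite l2normZ ger0_norm ?invr_ge0 ?l2norm_ge0// mulVf.
by rewrite -scalemxAr l2normZ ger0_norm ?invr_ge0 ?l2norm_ge0// mulrC.
Qed.

End OpNorm.

Section KKT.
Context {R : realType} {n m : nat}.
Variables (H : 'M[R]_n) (J : 'M[R]_(m, n)) (zeta : R).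
Hypothesis zeta_gt0 : 0 < zeta.
Hypothesis curv : forall u, J *m u = 0 ->
  zeta * l2norm u ^+ 2 <= dotv u (H *m u).

Lemma kkt_mxE (p : 'cV[R]_n) (q : 'cV[R]_m) :
  kkt_mx H J *m col_mx p q = col_mx (H *m p + J^T *m q) (J *m p).
Proof. by rewrite mul_block_col mul0mx addr0. Qed.

(** The zero second block puts [p] in the kernel of [J], so [J^T *m q] is orthogonal to [p] and the
    curvature condition applies to [p]. *)
Lemma kkt_curv (p r : 'cV[R]_n) (q : 'cV[R]_m) :
  kkt_mx H J *m col_mx p q = col_mx r 0 ->
  dotv p (H *m p) = dotv p r /\ zeta * l2norm p ^+ 2 <= dotv p r.
Proof.
rewrite kkt_mxE => /eq_col_mx[<- Jp].
have -> : dotv p (H *m p + J^T *m q) = dotv p (H *m p).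
  by rewrite dotvDr -dotv_mulmx Jp (dotvC 0) dotv0r addr0.
by split=> //; apply: curv.
Qed.

(** Curvature against Cauchy-Schwarz. It is applied to the direction error, with [r = - g_err], and
    to the columns [kkt_col], with [r] a basis vector. *)
Lemma kkt_bound (p r : 'cV[R]_n) (q : 'cV[R]_m) :
  kkt_mx H J *m col_mx p q = col_mx r 0 -> l2norm p <= l2norm r / zeta.
Proof.
move=> /kkt_curv[_ le]; rewrite ler_pdivlMr//.
have [->|p0] := eqVneq (l2norm p) 0; first by rewrite mul0r l2norm_ge0.
have pp : 0 < l2norm p by rewrite lt_def p0 l2norm_ge0.
rewrite -(ler_pM2l pp) mulrA -expr2 mulrC (le_trans le)//; exact: dotv_le.
Qed.

(** A kernel vector (p, q) has p = 0 by curvature, hence J^T q = 0; a nonzero q would then be an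
    eigenvector of J J^T for the eigenvalue 0. *)
Lemma kkt_unit : ~ singular_value J 0 -> kkt_mx H J \in unitmx.
Proof.
move=> J0; rewrite -unitmx_tr -row_free_unit -kermx_eq0; apply/eqP/row_matrixP
  => i.
rewrite row0; set v := row i _.
have vK : v *m (kkt_mx H J)^T = 0.
  by apply/sub_kermxP; exact: row_sub.
have {}vK : kkt_mx H J *m v^T = 0 by apply: trmx_inj; rewrite trmx_mul trmxK vK
  trmx0.
apply: trmx_inj; rewrite trmx0 -(vsubmxK v^T) in vK *.
move: (usubmx _) (dsubmx _) vK => {}p q; rewrite -[RHS]col_mx0 => Kpq.
have p0 : p = 0.
  apply: l2norm_eq0; apply/eqP; rewrite eq_le l2norm_ge0 andbT.
  by rewrite (le_trans (kkt_bound Kpq))// l2norm0 mul0r.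
move: Kpq; rewrite kkt_mxE p0 !mulmx0 add0r => /eq_col_mx[Jq _].
suff -> : q = 0 by rewrite col_mx0.
apply/eqP/negPn/negP => q0; apply: J0; split=> //.
apply/eigenvalueP; exists q^T; last by rewrite -(inj_eq trmx_inj) trmxK trmx0.
rewrite expr0n scale0r; apply: trmx_inj.
by rewrite trmx0 trmx_mul trmxK trmx_mul trmxK -mulmxA Jq mulmx0.
Qed.

End KKT.

(** * Smoothness and the choice of constants *)

Section Smooth.
Context {R : realType} {n : nat}.
Implicit Types (h : 'cV[R]_n -> R) (x y v : 'cV[R]_n).

Lemma derive_dotv_grad h x v : differentiable h x ->
  'D_v h x = dotv (grad h x) v.
Proof.
move=> dh; rewrite deriveE//.
have {1}-> : v = \sum_i v i 0 *: delta_mx i 0.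
  apply/colP => j; rewrite summxE (bigD1 j)//= big1 => [|i ij].
    by rewrite !mxE !eqxx mulr1 addr0.
  by rewrite !mxE eq_sym (negbTE ij) mulr0.
rewrite linear_sum; apply: eq_bigr => i _ /=.
by rewrite linearZ mxE deriveE// mulrC.
Qed.

(** The difference quotients of the one-variable function at [t] are exactly those of [h] at
    [x + t *: v] in the direction [v]. *)
Lemma is_derive_line h x v (t : R) : differentiable h (x + t *: v) ->
  is_derive t 1 (fun s : R => h (x + s *: v)) (dotv (grad h (x + t *: v)) v).
Proof.
move=> dh; have dv : derivable h (x + t *: v) v by exact: diff_derivable.
have E : (fun u : R => u^-1 *: (h (x + (u *: 1 + t) *: v) - h (x + t *: v))) =
         (fun u : R => u^-1 *: (h (u *: v + (x + t *: v)) - h (x + t *: v))).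
  apply/funext => u; congr (_ *: (h _ - _)).
  by rewrite scalerDl addrCA /GRing.scale /= mulr1.
apply: DeriveDef; first by rewrite /derivable /= E.
by rewrite -derive_dotv_grad// /derive /= E.
Qed.

Lemma taylor_lipschitz_grad h L x v : (forall y, differentiable h y) ->
  lipschitz_grad L h ->
  `|h (x + v) - h x - dotv (grad h x) v| <= L / 2 * l2norm v ^+ 2.
Proof.
move=> dh lh; set a := dotv _ v; set q := l2norm v ^+ 2.
(* The factor [s], taken to be 1 and -1, treats both signs of the remainder at once. *)
suff key (s : R) : `|s| <= 1 -> s * (h (x + v) - h x - a) <= L / 2 * q.
  rewrite ler_norml; apply/andP; split.
    by rewrite lerNl -mulN1r key// normrN1.
  by rewrite -[leLHS]mul1r key// normr1.
move=> s1.
(* The Lipschitz condition bounds the first part of [dg t] by L q t, which the quadratic term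
   cancels. Hence [dg <= 0] on [0, 1], and the mean value theorem gives g 1 <= g 0, which is the
   claim. *)
pose g t := s * (h (x + t *: v) - t * a) - L / 2 * q * t ^+ 2.
pose dg t := s * (dotv (grad h (x + t *: v)) v - a) - L / 2 * q * (t *+ 2).
have gd (t : R) : is_derive t 1 g (dg t).
  have d1 := is_derive_line (dh (x + t *: v)).
  apply: is_derive_eq; rewrite /dg /GRing.scale /=; ring.
have gc : {within `[0, 1], continuous g}.
  by apply: derivable_within_continuous => t _; have [] := gd t.
have [//|t] := MVT_segment _ (fun t _ => gd t) gc; rewrite in_itv /= => /andP[t0
  t1].
rewrite subr0 mulr1 /g /dg !scale1r scale0r addr0 => E.
suff : s * (dotv (grad h (x + t *: v)) v - a) <= L * q * t.
  rewrite -mulr_natr in E; nra.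
rewrite -dotvBl; set z := dotv _ v.
rewrite (le_trans (ler_norm _))// normrM.
have zle : `|z| <= L * q * t.
  rewrite (le_trans (norm_dotv_le _ _))//.
  rewrite (_ : L * q * t = L * l2norm (t *: v) * l2norm v).
    rewrite ler_wpM2r ?l2norm_ge0//.
    by have := lh (x + t *: v) x; rewrite addrAC subrr add0r.
  by rewrite l2normZ ger0_norm// /q; ring.
by rewrite (le_trans _ zle)// ler_piMl.
Qed.

Lemma continuous_grad_coord h i : C1 h -> continuous (fun x => grad h x i 0).
Proof.
move=> [_ ch] x; have := @coord_continuous R n 1 i 0 (grad h x).
by apply: (@continuous_comp _ _ _ (grad h) (fun M : 'cV[R]_n => M i 0)); exact:
  ch.
Qed.

End Smooth.

Section Average.
Context {R : realType} {n N : nat}.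
Variables (f : 'I_N -> 'cV[R]_n -> R) (L : R).
Hypothesis f_diff : forall i x, differentiable (f i) x.
Hypothesis f_lip : forall i, lipschitz_grad L (f i).

Let favgE : favg f = N%:R^-1 *: \sum_(i < N) f i.
Proof. by apply/funext => x; rewrite /favg fct_sumE. Qed.

Lemma differentiable_favg x : differentiable (favg f) x.
Proof. by rewrite favgE; apply: differentiableZ; exact: differentiable_sum. Qed.

Lemma grad_favg x : grad (favg f) x = N%:R^-1 *: \sum_(i < N) grad (f i) x.
Proof.
apply/colP => j; rewrite !mxE summxE favgE deriveZ /=; last first.
  by apply: diff_derivable; exact: differentiable_sum.
rewrite derive_sum => [|i]; last exact: diff_derivable.
by congr (_ * _); apply: eq_bigr => i _; rewrite mxE.
Qed.

Lemma lipschitz_grad_favg : (0 < N)%N -> lipschitz_grad L (favg f).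
Proof.
move=> N0 x y; rewrite !grad_favg -scalerBr -sumrB l2normZ ger0_norm
  ?invr_ge0//.
rewrite mulrC ler_pdivrMr ?ltr0n// (le_trans (l2norm_sum _ _ _))//.
rewrite (le_trans (ler_sum _ (fun i _ => f_lip i x y)))//.
by rewrite sumr_const card_ord mulr_natr.
Qed.

(** Each summand is [g] plus a difference of gradients of a single [f i]. The bound holds for every
    batch, so [gbar] is bounded surely, and not only in mean, once the deviation is. *)
Lemma l2norm_svrg_le (b : nat) (B : {set 'I_N}) (x y g : 'cV[R]_n) :
  (0 < b)%N -> #|B| = b ->
  l2norm (b%:R^-1 *: \sum_(i in B) (grad (f i) x - (grad (f i) y - g))) <=
    L * l2norm (x - y) + l2norm g.
Proof.
move=> b0 Bb; rewrite l2normZ ger0_norm ?invr_ge0// mulrC ler_pdivrMr ?ltr0n//.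
rewrite (le_trans (l2norm_sum _ _ _))//.
have le i : l2norm (grad (f i) x - (grad (f i) y - g)) <= L * l2norm (x - y) +
  l2norm g.
  rewrite opprB addrA addrAC (le_trans (l2normD _ _))// lerD2r; exact: f_lip.
rewrite (le_trans (ler_sum _ (fun i _ => le i)))//.
by rewrite sumr_const Bb mulr_natr.
Qed.

End Average.

(** * Step-size constant and growth of the potential weights *)

Section Constants.
Context {R : realType}.
Variables (L taumin kl zeta : R) (b : nat).
Hypotheses (taumin_gt0 : 0 < taumin) (kl_gt0 : 0 < kl) (zeta_gt0 : 0 < zeta).
Hypothesis b_gt0 : (0 < b)%N.

(* The constant mu_0; [expR 1] bounds the growth [(1 + rho) ^+ S] of [lam]. *)
Definition step_coeff : R :=
  Num.min (Num.min 1 b%:R^-1) (taumin * kl / (1 + 2 * expR 1 * b%:R)).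

Let bR : 0 < b%:R :> R. Proof. by rewrite ltr0n. Qed.

Let den_gt0 : 0 < 1 + 2 * expR 1 * b%:R :> R.
Proof. by rewrite addr_gt0// !mulr_gt0// expR_gt0. Qed.

Lemma step_coeff_gt0 : 0 < step_coeff.
Proof. by rewrite !lt_min ltr01 invr_gt0 bR divr_gt0// mulr_gt0. Qed.

Lemma step_coeff_le1 : step_coeff <= 1.
Proof. by rewrite !ge_min lexx. Qed.

Let step_coeff_le_inv : step_coeff * b%:R <= 1.
Proof. by rewrite -ler_pdivlMr// div1r !ge_min lexx orbT. Qed.

Let step_coeff_le_den : step_coeff * (1 + 2 * expR 1 * b%:R) <= taumin * kl.
Proof. by rewrite -ler_pdivlMr// ge_min lexx orbT. Qed.

(** The recursion runs backwards from [lam S = 0], so the induction is on the number S - s of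
    remaining steps. Each of them contributes at most C (1 + rho)^(S - s), and 1 + rho <= exp
    rho. *)
Lemma affine_recursion_bound (S : nat) (rho C : R) (lam : nat -> R) :
  0 <= rho -> 0 <= C -> lam S = 0 ->
  (forall s, (s < S)%N -> lam s = lam s.+1 * (rho + 1) + C) ->
  forall s, (s <= S)%N -> 0 <= lam s <= C * S%:R * expR (rho * S%:R).
Proof.
move=> rho0 C0 lamS lamE.
have rho1 : 1 <= rho + 1 by rewrite lerDr.
have rho1' : 0 <= rho + 1 by rewrite (le_trans ler01).
have key s : (s <= S)%N -> 0 <= lam s <= C * (S - s)%:R * (rho + 1) ^+ (S - s).
  move=> sS; rewrite -(subKn sS); move: (S - s)%N (leq_subr s S) => {s sS}.
  elim=> [|r IH] rS; first by rewrite subn0 lamS subnn mulr0 mul0r lexx.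
  have rS' := ltnW rS; have /andP[IH0 IH1] := IH rS'.
  rewrite lamE ?ltn_subrL ?(leq_trans _ rS)// -subSn//= subSS.
  rewrite !subKn// in IH1 *; rewrite addr_ge0 ?mulr_ge0//= exprSr mulrA.
  have -> : C * r.+1%:R * (rho + 1) ^+ r * (rho + 1) =
      C * r%:R * (rho + 1) ^+ r * (rho + 1) + C * (rho + 1) ^+ r.+1.
    by rewrite -[r.+1%:R]natr1 exprSr; ring.
  by rewrite lerD ?ler_wpM2r ?ler_peMr ?exprn_ege1.
move=> s sS; have /andP[-> /= le] := key s sS; apply: (le_trans le).
have ler : (S - s)%:R <= S%:R :> R by rewrite ler_nat leq_subr.
apply: ler_pM => //; first by rewrite mulr_ge0.
- by rewrite exprn_ge0.
- by rewrite ler_wpM2l.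
rewrite mulrC expRM_natl (le_trans (_ : _ <= (rho + 1) ^+ S))//.
  by rewrite ler_weXn2l// leq_subr.
by rewrite lerXn2r ?nnegrE ?expR_ge0// addrC expR_ge1Dx.
Qed.

(* Here [M] stands for N^gamma, so that N^(gamma/2) and N^(3 gamma/2) are
   [Num.sqrt M] and [M * Num.sqrt M]. *)
Lemma lyapunov_coeff_bound (A M alpha z : R) (S : nat) (lam Lam : nat -> R) :
  0 < A -> b%:R < M ->
  alpha = step_coeff * b%:R / (A * M) -> z = A / Num.sqrt M ->
  S%:R <= M * Num.sqrt M /
    (step_coeff * (b%:R + L ^+ 2 / (A ^+ 2 * kl * zeta))) ->
  lam S = 0 ->
  (forall s, (s < S)%N -> lam s =
     lam s.+1 * (alpha ^+ 2 * L ^+ 2 / (kl * b%:R * zeta) + alpha * z + 1)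
     + alpha ^+ 2 * A * L ^+ 2 / (2 * kl * b%:R * zeta)) ->
  (forall s, (s < S)%N -> Lam s =
     alpha - alpha ^+ 2 * A / (2 * taumin * kl)
     - lam s.+1 * (alpha / (taumin * kl)) * (alpha + z^-1)) ->
  (forall s, (s <= S)%N -> 0 <= lam s) /\
  forall s, (s < S)%N -> step_coeff / 2 * b%:R / (A * M) <= Lam s.
Proof.
move=> A0 bM alphaE zE Sle lamS lamE LamE.
have mu0 := step_coeff_gt0; set mu := step_coeff in mu0 alphaE Sle *.
have mub : mu * b%:R <= 1 := step_coeff_le_inv.
have muden : mu * (1 + 2 * expR 1 * b%:R) <= taumin * kl := step_coeff_le_den.
have M1 : 1 <= M by rewrite (le_trans _ (ltW bM))// ler1n.
have M0 : 0 < M by rewrite (lt_le_trans ltr01).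
set r := Num.sqrt M in zE Sle.
have r0 : 0 < r by rewrite sqrtr_gt0.
have rM : M = r ^+ 2 by rewrite sqr_sqrtr// ltW.
have r1 : 1 <= r by rewrite -sqrtr1 ler_wsqrtr.
set th := L ^+ 2 / (A ^+ 2 * kl * zeta) in Sle.
have th0 : 0 <= th by rewrite divr_ge0 ?sqr_ge0// !mulr_ge0 ?sqr_ge0// ltW.
have bth : 0 < b%:R + th by rewrite ltr_pwDl.
have al0 : 0 < alpha by rewrite alphaE divr_gt0 ?mulr_gt0.
have z0 : 0 < z by rewrite zE divr_gt0.
set rho := alpha ^+ 2 * L ^+ 2 / (kl * b%:R * zeta) + alpha * z.
set C := alpha ^+ 2 * A * L ^+ 2 / (2 * kl * b%:R * zeta).
have rho0 : 0 <= rho.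
  rewrite addr_ge0 ?(mulr_ge0 (ltW al0) (ltW z0))//.
  rewrite divr_ge0 ?(mulr_ge0 (sqr_ge0 _) (sqr_ge0 _))//.
  by rewrite ltW// !mulr_gt0.
have C0 : 0 <= C.
  rewrite divr_ge0 ?(mulr_ge0 (mulr_ge0 (sqr_ge0 _) (ltW A0)) (sqr_ge0 _))//.
  by rewrite ltW// !mulr_gt0.
have ler s := affine_recursion_bound rho0 C0 lamS lamE (s := s).
split=> [s /ler/andP[]//|s sS].
have /andP[l0 l1] := ler s.+1 sS.
have A' : A != 0 by rewrite gt_eqF.
have r' : r != 0 by rewrite gt_eqF.
have kl' : kl != 0 by rewrite gt_eqF.
have ze' : zeta != 0 by rewrite gt_eqF.
have b' : b%:R != 0 :> R by rewrite gt_eqF.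
have mu' : mu != 0 by rewrite gt_eqF.
have bth' : b%:R + th != 0 by rewrite gt_eqF.
have rhoE : rho = mu * (mu * b%:R * (th / r) + b%:R) / (M * r).
  by rewrite /rho alphaE zE /th rM; field; rewrite A' r' kl' ze' b'.
have CE : C = mu ^+ 2 * b%:R * A * th / (2 * M ^+ 2).
  by rewrite /C alphaE /th rM; field; rewrite A' r' kl' ze' b'.
have S0 : 0 <= S%:R :> R by [].
(* The admissible S is calibrated for this: inserting it leaves (mu b th / r + b) / (b + th), which
   is at most 1 because mu b <= 1 and r >= 1. *)
have rhoS : rho * S%:R <= 1.
  have le1 : rho * S%:R <= rho * (M * r / (mu * (b%:R + th))).
    by rewrite ler_wpM2l.
  rewrite (le_trans le1)// rhoE.
  have -> : mu * (mu * b%:R * (th / r) + b%:R) / (M * r) * (M * r / (mu * (b%:R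
    + th)))
     = (mu * b%:R * (th / r) + b%:R) / (b%:R + th).
    by rewrite rM; field; rewrite bth' mu' r'.
  rewrite ler_pdivrMr// mul1r addrC lerD2l.
  have thr : th / r <= th by rewrite ler_pdivrMr// ler_peMr.
  rewrite (le_trans _ thr)// ler_piMl// divr_ge0// ltW//.
(* With [rhoS] the exponential is at most e; the product C S leaves the factor th / (b + th) <= 1,
   which is dropped. *)
have lamle : lam s.+1 <= expR 1 * mu * A * b%:R / (2 * r).
  apply: (le_trans l1).
  have le1 : C * S%:R * expR (rho * S%:R) <=
      C * (M * r / (mu * (b%:R + th))) * expR 1.
    apply: ler_pM; rewrite ?expR_ge0 ?ler_expR//; first exact: mulr_ge0.
    exact: ler_wpM2l.
  apply: (le_trans le1); rewrite CE.
  have -> : mu ^+ 2 * b%:R * A * th / (2 * M ^+ 2) * (M * r / (mu * (b%:R +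
    th))) * expR 1
     = expR 1 * mu * A * b%:R / (2 * r) * (th / (b%:R + th)).
    by rewrite rM; field; rewrite bth' mu' r'.
  rewrite ler_piMr//.
    rewrite divr_ge0 ?mulr_ge0 ?expR_ge0// ltW//.
  by rewrite ler_pdivrMr// mul1r lerDr.
rewrite LamE//.
(* Once [alpha] is factored out, the corrections must not exceed 1/2; this is the origin of the
   factor 1/2 in the lower bound. *)
have -> : alpha - alpha ^+ 2 * A / (2 * taumin * kl)
     - lam s.+1 * (alpha / (taumin * kl)) * (alpha + z^-1) =
   alpha * (1 - (alpha * A / 2 + lam s.+1 * (alpha + z^-1)) / (taumin * kl)).
  by field; rewrite ?mulf_neq0 ?gt_eqF// mulr_gt0.
have -> : mu / 2 * b%:R / (A * M) = alpha * (1 / 2).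
  by rewrite alphaE; field; rewrite A' gt_eqF.
rewrite ler_pM2l// lerBrDr -lerBrDl ler_pdivrMr ?mulr_gt0//.
have -> : 1 - 1 / 2 = 1 / 2 :> R by field.
(* The three bounds below contribute mu / 2, e mu b / 2 and e mu b / 2. Their sum explains the
   denominator 1 + 2 e b in [step_coeff]. *)
suff : alpha * A / 2 + lam s.+1 * (alpha + z^-1) <=
       mu * (1 + 2 * expR 1 * b%:R) / 2 by lra.
have e1 : alpha * A <= mu.
  have -> : alpha * A = mu * (b%:R / M) by rewrite alphaE; field; rewrite A'
    gt_eqF.
  rewrite ler_piMr ?(ltW mu0)//; rewrite ler_pdivrMr// mul1r; exact: ltW.
have e2 : lam s.+1 * alpha <= expR 1 * mu * b%:R / 2.
  have -> : expR 1 * mu * b%:R / 2 = expR 1 * mu * A * b%:R / (2 * r) * (r / A).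
    by field; rewrite A' r'.
  apply: ler_pM => //; first exact: ltW.
  rewrite alphaE ler_pdivrMr ?mulr_gt0// (_ : r / A * (A * M) = r ^+ 3); last
    first.
    by rewrite rM; field.
  by rewrite (le_trans mub)// exprn_ege1.
have e3 : lam s.+1 * z^-1 <= expR 1 * mu * b%:R / 2.
  have -> : expR 1 * mu * b%:R / 2 = expR 1 * mu * A * b%:R / (2 * r) * z^-1.
    by rewrite zE; field; rewrite A' r'.
  by rewrite ler_wpM2r// invr_ge0 ltW.
rewrite mulrDr; lra.
Qed.

End Constants.

(** * Measurability of random matrices *)

Section Measurability.
Context {R : realType} d (T : measurableType d).

Lemma measurable_fun_inv (f : T -> R) :
  measurable_fun setT f -> measurable_fun setT (fun w => (f w)^-1).
Proof.
move=> mf; apply: (@measurableT_comp _ _ _ _ _ _ (fun x : R => x^-1)) => //.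
have -> : [set: R] = [set x | x != 0] `|` [set 0].
  apply/seteqP; split=> // x _ /=.
  by have [->|x0] := eqVneq x 0; [right|left].
have o : open [set x : R | x != 0].
  rewrite (_ : [set x : R | x != 0] = ~` [set 0]); first
    exact/closed_openC/closed_eq.
  by apply/seteqP; split=> x /= /eqP.
apply/measurable_funU; [exact: open_measurable|exact: measurable_set1|split].
  apply: open_continuous_measurable_fun => // x.
  by rewrite inE /= => x0; exact: inv_continuous.
exact: measurable_fun_set1.
Qed.

Lemma measurable_sumT (I : Type) (r : seq I) (P : pred I) (h : I -> T -> R) :
  (forall i, P i -> measurable_fun setT (h i)) ->
  measurable_fun setT (fun w => \sum_(i <- r | P i) h i w).
Proof.
move=> mh; under eq_fun do rewrite big_mkcond.
by apply: measurable_sum => i; case: (boolP (P i)) => // /mh.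
Qed.

Lemma measurable_prodT (I : eqType) (r : seq I) (h : I -> T -> R) :
  (forall i, measurable_fun setT (h i)) ->
  measurable_fun setT (fun w => \prod_(i <- r) h i w).
Proof. by move=> mh; apply: measurable_prod. Qed.

Section RandomMatrices.
Variables p q r : nat.

Lemma random_mxD (A B : T -> 'M[R]_(p, q)) :
  random_mx A -> random_mx B -> random_mx (fun w => A w + B w).
Proof.
by move=> mA mB i j; under eq_fun do rewrite mxE; exact: measurable_funD.
Qed.

Lemma random_mxN (A : T -> 'M[R]_(p, q)) :
  random_mx A -> random_mx (fun w => - A w).
Proof.
by move=> mA i j; under eq_fun do rewrite mxE; exact: measurable_funN.
Qed.

Lemma random_mxB (A B : T -> 'M[R]_(p, q)) :
  random_mx A -> random_mx B -> random_mx (fun w => A w - B w).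
Proof. by move=> mA mB; apply: random_mxD => //; exact: random_mxN. Qed.

Lemma random_mx_cst (A : 'M[R]_(p, q)) : random_mx (fun _ : T => A).
Proof. by move=> i j; exact: measurable_cst. Qed.

Lemma random_mxM (A : T -> 'M[R]_(p, q)) (B : T -> 'M[R]_(q, r)) :
  random_mx A -> random_mx B -> random_mx (fun w => A w *m B w).
Proof.
move=> mA mB i j; under eq_fun do rewrite mxE.
by apply: measurable_sumT => k _; exact: measurable_funM.
Qed.

Lemma random_col_mx (A : T -> 'M[R]_(p, r)) (B : T -> 'M[R]_(q, r)) :
  random_mx A -> random_mx B -> random_mx (fun w => col_mx (A w) (B w)).
Proof.
move=> mA mB i j; case: (split_ordP i) => k ->.
  by under eq_fun do rewrite col_mxEu; exact: mA.
by under eq_fun do rewrite col_mxEd; exact: mB.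
Qed.

Lemma random_dotv (u v : T -> 'cV[R]_p) : random_mx u -> random_mx v ->
  measurable_fun setT (fun w => dotv (u w) (v w)).
Proof.
by move=> mu mv; apply: measurable_sumT => i _; exact: measurable_funM.
Qed.

Lemma random_l2norm (u : T -> 'cV[R]_p) : random_mx u ->
  measurable_fun setT (fun w => l2norm (u w)).
Proof.
move=> mu; apply: (@measurableT_comp _ _ _ _ _ _ (@Num.sqrt R)).
  apply: continuous_measurable_fun. exact: sqrt_continuous.
by apply: measurable_sumT => i _; exact: measurable_funX.
Qed.

End RandomMatrices.

Lemma random_det p (A : T -> 'M[R]_p) : random_mx A ->
  measurable_fun setT (fun w => \det (A w)).
Proof.
move=> mA; apply: measurable_sumT => s _; apply: measurable_funM => //.
by apply: measurable_prodT => i; exact: mA.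
Qed.

(** Entries of the inverse are cofactors over the determinant; invertibility at every outcome
    excludes the default branch of [invmx]. It will be used for the KKT matrix over a
    sub-sigma-algebra. *)
Lemma random_invmx p (A : T -> 'M[R]_p) : random_mx A ->
  (forall w, A w \in unitmx) -> random_mx (fun w => invmx (A w)).
Proof.
move=> mA uA i j; under eq_fun do rewrite /invmx uA !mxE.
apply: measurable_funM; first exact/measurable_fun_inv/random_det.
apply: measurable_funM => //; apply: random_det => a c.
by under eq_fun do rewrite !mxE; exact: mA.
Qed.

Lemma random_kkt_mx n m (H : T -> 'M[R]_n) (J : T -> 'M[R]_(m, n)) :
  random_mx H -> random_mx J -> random_mx (fun w => kkt_mx (H w) (J w)).
Proof.
move=> mH mJ i j.
case: (split_ordP i) => a ->; case: (split_ordP j) => c ->.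
- by under eq_fun do rewrite block_mxEul; exact: mH.
- by under eq_fun do rewrite block_mxEur mxE; exact: mJ.
- by under eq_fun do rewrite block_mxEdl; exact: mJ.
- by under eq_fun do rewrite block_mxEdr mxE; exact: measurable_cst.
Qed.

(* The functions [h \o Y] are limits of [h] composed with coordinatewise
   roundings of [Y], which take countably many values. *)
Lemma continuous_random_mx n (h : 'cV[R]_n -> R) (Y : T -> 'cV[R]_n) :
  continuous h -> random_mx Y -> measurable_fun setT (fun w => h (Y w)).
Proof.
move=> ch mY.
pose cell k (w : T) : 'cV[int]_n := \col_i Num.floor (k.+1%:R * Y w i 0).
pose grid k (z : 'cV[int]_n) : 'cV[R]_n := \col_i (k.+1%:R^-1 * (z i 0)%:~R).
apply: (@measurable_fun_cvg _ _ _ _ (fun k w => h (grid k (cell k w)))) => [k|w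
  _].
  move=> _ B mB; rewrite setTI.
  (* A cell is a finite intersection over coordinates, written as the complement of a union so that
     closure under countable unions covers it as well. *)
  have -> : (fun w => h (grid k (cell k w))) @^-1` B =
      \bigcup_(z in [set z | B (h (grid k z))])
        ~` (\bigcup_(i in [set: 'I_n]) ~` [set w | cell k w i 0 = z i 0]).
    apply/seteqP; split=> [w /= Bw|w [z /= Bz wz] /=].
      by exists (cell k w) => // -[i _] /=.
    suff -> : cell k w = z by [].
    apply/colP => i; apply: contrapT => ne; apply: wz; exists i => //.
  rewrite bigcup_mkcond; apply: countable_bigcupT_measurable => // z.
  case: ifP => // _; apply: measurableC.
  apply: countable_bigcupT_measurable => [//|i]; apply: measurableC.
  have -> : [set w | cell k w i 0 = z i 0] =
      (fun w => k.+1%:R * Y w i 0) @^-1` `[(z i 0)%:~R, (z i 0 +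
        1)%:~R[%classic.
    apply/seteqP; split=> w /=; rewrite in_itv /= mxE.
      by move=> <-; rewrite floor_le floorD1_gt.
    by move=> /floor_def.
  rewrite -[X in measurable X]setTI; apply: measurable_funM => //.
apply: continuous_cvg; first exact: ch.
apply/cvg_ballP => e e0; near=> k; split=> // i j.
rewrite ord1 !mxE /ball /= /ball_.
have k0 : 0 < k.+1%:R :> R by [].
set a := Y w i 0; rewrite -[X in X - _](mulKf (lt0r_neq0 k0)) -mulrBr normrM.
rewrite gtr0_norm ?invr_gt0// mulrC ltr_pdivrMr//.
have /andP[le gt] := floor_itv (k.+1%:R * a).
rewrite ger0_norm ?subr_ge0//; apply: (@lt_trans _ _ 1).
  by rewrite ltrBlDl addrC -[X in X + _]/(1%:~R) -intrD addrC.
rewrite -ltr_pdivrMr// mul1r.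
by near: k; exact: near_infty_natSinv_lt (PosNum e0).
Unshelve. all: by end_near. Qed.

End Measurability.

(** * Expectation and orthogonality *)

(** Counts the superlevel sets that contain a point in the layer-cake approximation below. *)
Lemma sum_ltn_minn N t : (\sum_(i < N) (i < t) = minn N t)%N.
Proof.
elim: N => [|N IH]; first by rewrite big_ord0 min0n.
rewrite big_ord_recr /= IH; case: (ltnP N t) => h.
  by rewrite addn1 (minn_idPl h).
by rewrite addn0 (minn_idPr (leqW h)).
Qed.

Section Expectation.
Context {R : realType} d (T : measurableType d) (Q : probability T R).
Implicit Types X Y : T -> R.

Definition rintegrable X := Q.-integrable setT (EFin \o X).
Definition mean X : R := \int[Q]_w X w.

Lemma rintegrable_meas X : rintegrable X -> measurable_fun setT X.
Proof. by move=> /integrableP[/measurable_EFinP]. Qed.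

Lemma rintegrableD X Y : rintegrable X -> rintegrable Y ->
  rintegrable (fun w => X w + Y w).
Proof. by move=> iX iY; exact: (integrableD measurableT iX iY). Qed.

Lemma rintegrableZ a X : rintegrable X -> rintegrable (fun w => a * X w).
Proof. by move=> iX; apply: (integrableZl measurableT a iX). Qed.

Lemma rintegrableN X : rintegrable X -> rintegrable (fun w => - X w).
Proof. by move=> /(rintegrableZ (-1)); under eq_fun do rewrite mulN1r. Qed.

Lemma rintegrableB X Y : rintegrable X -> rintegrable Y ->
  rintegrable (fun w => X w - Y w).
Proof. by move=> iX /rintegrableN; exact: rintegrableD. Qed.

Lemma rintegrable_cst a : rintegrable (fun=> a).
Proof. exact: finite_measure_integrable_cst. Qed.

Lemma rintegrable_sum (I : Type) (r : seq I) (P : pred I) (F : I -> T -> R) :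
  (forall i, P i -> rintegrable (F i)) ->
  rintegrable (fun w => \sum_(i <- r | P i) F i w).
Proof.
move=> iF; elim: r => [|i r IH].
  by under eq_fun do rewrite big_nil; exact: rintegrable_cst.
under eq_fun do rewrite big_cons; case: (boolP (P i)) => [Pi|_ //].
by apply: rintegrableD => //; exact: iF.
Qed.

Lemma rintegrable_le X Y : measurable_fun setT X -> rintegrable Y ->
  (forall w, `|X w| <= Y w) -> rintegrable X.
Proof.
move=> mX iY le; apply: le_integrable iY => //; first exact/measurable_EFinP.
by move=> w _ /=; rewrite lee_fin (le_trans (le w))// ler_norm.
Qed.

Lemma meanD X Y : rintegrable X -> rintegrable Y ->
  mean (fun w => X w + Y w) = mean X + mean Y.
Proof. by move=> iX iY; exact: RintegralD. Qed.

Lemma meanZ a X : rintegrable X -> mean (fun w => a * X w) = a * mean X.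
Proof. by move=> iX; exact: RintegralZl. Qed.

Lemma meanB X Y : rintegrable X -> rintegrable Y ->
  mean (fun w => X w - Y w) = mean X - mean Y.
Proof. by move=> iX iY; exact: RintegralB. Qed.

Lemma mean_cst a : mean (fun=> a) = a.
Proof.
rewrite /mean Rintegral_cst// (_ : fine _ = 1) ?mulr1//.
by rewrite [X in fine X](probability_setT Q).
Qed.

Lemma mean_sum (I : Type) (r : seq I) (P : pred I) (F : I -> T -> R) :
  (forall i, P i -> rintegrable (F i)) ->
  mean (fun w => \sum_(i <- r | P i) F i w) = \sum_(i <- r | P i) mean (F i).
Proof.
move=> iF; elim: r => [|i r IH].
  by under [X in mean X]eq_fun do rewrite big_nil; rewrite mean_cst big_nil.
under [X in mean X]eq_fun do rewrite big_cons; rewrite big_cons.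
case: (boolP (P i)) => [Pi|_]; last exact: IH.
by rewrite meanD ?IH//; [exact: iF|exact: rintegrable_sum].
Qed.

Lemma mean_ae X Y : measurable_fun setT X -> measurable_fun setT Y ->
  {ae Q, forall w, X w = Y w} -> mean X = mean Y.
Proof.
move=> mX mY XY; congr fine; apply: ae_eq_integral => //.
- exact/measurable_EFinP.
- exact/measurable_EFinP.
- by apply: filterS XY => w /= ->.
Qed.

Lemma rintegrable_ae X Y : measurable_fun setT Y -> rintegrable X ->
  {ae Q, forall w, X w = Y w} -> rintegrable Y.
Proof.
move=> mY iX XY; apply/integrableP; split; first exact/measurable_EFinP.
have /integrableP[mX] := iX; rewrite (ae_eq_integral (fun w => `|(Y
  w)%:E|%E))//.
- exact: measurableT_comp.
- by apply: measurableT_comp => //; exact/measurable_EFinP.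
- by apply: filterS XY => w /= ->.
Qed.

(** Reduced to pointwise monotonicity: [Y] agrees almost surely with max(X, Y), which dominates [X]
    everywhere. *)
Lemma mean_le X Y : rintegrable X -> rintegrable Y ->
  {ae Q, forall w, X w <= Y w} -> mean X <= mean Y.
Proof.
move=> iX iY XY; have mX := rintegrable_meas iX; have mY := rintegrable_meas iY.
have mZ : measurable_fun setT (fun w => Num.max (X w) (Y w)).
  exact: measurable_maxr.
have XZ : {ae Q, forall w, Y w = Num.max (X w) (Y w)}.
  by apply: filterS XY => w /max_r.
rewrite (mean_ae mY mZ XZ); apply: le_Rintegral => //.
  exact: rintegrable_ae XZ.
by move=> w _; rewrite le_max lexx.
Qed.

Lemma mean_eq0_ae X : rintegrable X -> (forall w, 0 <= X w) -> mean X = 0 ->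
  {ae Q, forall w, X w = 0}.
Proof.
move=> iX X0 EX; have mX := rintegrable_meas iX.
have /(ae_eq_integral_abs Q measurableT) : measurable_fun setT (EFin \o X).
  exact/measurable_EFinP.
case=> + _; case.
  rewrite (eq_integral (EFin \o X)) => [|w _]; last by rewrite /= ger0_norm.
  by rewrite -[LHS]fineK ?[fine _]EX//; exact: integrable_fin_num.
by move=> N [mN N0 sN]; exists N; split => // w /= Xw; apply: sN => /= /(_ I)[].
Qed.

Lemma mean_norm_le X : rintegrable X -> `|mean X| <= mean (fun w => `|X w|).
Proof. by move=> iX; exact: le_normr_Rintegral. Qed.

Lemma rintegrable_norm X : rintegrable X -> rintegrable (fun w => `|X w|).
Proof. exact: integrable_norm. Qed.

(** The working class for integrability: unlike the integrable functions it is closed under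
    products. The bound is almost sure because the estimates hold only on the merit event, which has
    full measure for the conditioned probability. *)
Definition essbounded X :=
  measurable_fun setT X /\ exists K, {ae Q, forall w, `|X w| <= K}.

Lemma essbounded_integrable X : essbounded X -> rintegrable X.
Proof.
move=> [mX [K XK]]; pose Y w := Num.max (- K) (Num.min K (X w)).
have mY : measurable_fun setT Y.
  by apply: measurable_maxr => //; exact: measurable_minr.
have YX : {ae Q, forall w, Y w = X w}.
  by apply: filterS XK => w; rewrite ler_norml => /andP[le1 le2]; rewrite /Y
    min_r// max_r.
apply: rintegrable_ae YX => //; apply: rintegrable_le (rintegrable_cst `|K|) _
  => // w.
rewrite /Y; case: (lerP K (X w)) => h; case: (lerP (- K) _) => h' //;
  rewrite ?normrN ?normr_id//; have := ler_norm K.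
by move=> h2; rewrite ler_norml; apply/andP; split; lra.
Qed.

Lemma essbounded_cst a : essbounded (fun=> a).
Proof. by split=> //; exists `|a|; exact: aeW. Qed.

Lemma essboundedD X Y : essbounded X -> essbounded Y ->
  essbounded (fun w => X w + Y w).
Proof.
move=> [mX [K XK]] [mY [M YM]]; split; first exact: measurable_funD.
exists (K + M); apply: filterS2 XK YM => w le1 le2.
by rewrite (le_trans (ler_normD _ _))// lerD.
Qed.

Lemma essboundedM X Y : essbounded X -> essbounded Y ->
  essbounded (fun w => X w * Y w).
Proof.
move=> [mX [K XK]] [mY [M YM]]; split; first exact: measurable_funM.
exists (K * M); apply: filterS2 XK YM => w le1 le2.
by rewrite normrM ler_pM.
Qed.

Lemma essboundedZ a X : essbounded X -> essbounded (fun w => a * X w).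
Proof. by move=> bX; apply: essboundedM => //; exact: essbounded_cst. Qed.

Lemma essboundedN X : essbounded X -> essbounded (fun w => - X w).
Proof. by move=> /(essboundedZ (-1)); under eq_fun do rewrite mulN1r. Qed.

Lemma essboundedB X Y : essbounded X -> essbounded Y ->
  essbounded (fun w => X w - Y w).
Proof. by move=> bX /essboundedN; exact: essboundedD. Qed.

Lemma essbounded_indic (A : set T) : measurable A ->
  essbounded (\1_A : T -> R).
Proof.
move=> mA; split; first exact: measurable_indic.
by exists 1; apply: aeW => w; rewrite indicE ger0_norm// lern1 leq_b1.
Qed.

Section Orthogonality.
Variables (F : set (set T)) (xi : T -> R).
Hypotheses (F_meas : F `<=` measurable) (ixi : rintegrable xi).
Hypothesis xi_null : forall B, F B -> mean (fun w => \1_B w * xi w) = 0.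

Let Fmeas (h : T -> R) := forall B, measurable B -> F (h @^-1` B).

Let Fmeas_fun h : Fmeas h -> measurable_fun setT h.
Proof. by move=> mh _ B mB; rewrite setTI; exact/F_meas/mh. Qed.

Let imul (h : T -> R) K : measurable_fun setT h -> (forall w, `|h w| <= K) ->
  rintegrable (fun w => h w * xi w).
Proof.
move=> mh hK; apply: (rintegrable_le (Y := fun w => K * `|xi w|)).
- by apply: measurable_funM => //; exact: rintegrable_meas.
- exact/rintegrableZ/rintegrable_norm.
- by move=> w; rewrite normrM ler_wpM2r.
Qed.

(* Layer-cake approximation: [h] is uniformly close to a multiple of a finite
   sum of indicators of its superlevel sets. *)
Let mean_mul_ge0 (h : T -> R) K : Fmeas h -> (forall w, 0 <= h w <= K) ->
  mean (fun w => h w * xi w) = 0.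
Proof.
move=> Fh hK; have mh := Fmeas_fun Fh.
have h0 w : 0 <= h w by have /andP[] := hK w.
have hnK w : `|h w| <= K by rewrite ger0_norm//; have /andP[] := hK w.
suff le n : `|mean (fun w => h w * xi w)| <= n.+1%:R^-1 * mean (fun w => `|xi
  w|).
  apply/eqP; rewrite -normr_le0; apply/ler_addgt0Pl => e e0.
  have := le (Num.truncn (mean (fun w => `|xi w|) / e)).
  move=> /le_trans; apply; rewrite addr0 mulrC ler_pdivrMr//.
  rewrite mulrC -ler_pdivrMr//; exact/ltW/truncnS_gt.
(* Since h <= K, this many levels exhaust the values of [h]. With thresholds at [i.+1] rather than
   [i], the number of levels reached at [w] is exactly the integer part of (n+1) h w, so [g] is [h]
   rounded down to the grid. *)
pose N := (Num.truncn (n.+1%:R * K)).+1.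
pose B i : set T := h @^-1` `[i.+1%:R / n.+1%:R, +oo[%classic.
have FB i : F (B i) by apply: Fh.
pose g w := n.+1%:R^-1 * \sum_(i < N) \1_(B i) w : R.
have mg : measurable_fun setT g.
  apply: measurable_funM => //; apply: measurable_sumT => i _.
  exact/measurable_indic/F_meas.
have gE w : g w = n.+1%:R^-1 * (Num.truncn (n.+1%:R * h w))%:R.
  congr (_ * _); have t0 : 0 <= n.+1%:R * h w by rewrite mulr_ge0.
  have le : (Num.truncn (n.+1%:R * h w) <= N)%N.
    by rewrite ltnW// ltnS le_truncn// ler_wpM2l//; have /andP[] := hK w.
  rewrite (eq_bigr (fun i : 'I_N => (i < Num.truncn (n.+1%:R * h w))%:R)) => [|i
    _].
    by rewrite -natr_sum sum_ltn_minn (minn_idPr le).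
  rewrite indicE; congr (_%:R); congr nat_of_bool; apply/idP/idP.
    by rewrite inE /B /= in_itv /= andbT ler_pdivrMr// mulrC truncn_gt_nat.
  by rewrite inE /B /= in_itv /= andbT ler_pdivrMr// mulrC truncn_gt_nat.
have hg w : `|h w - g w| <= n.+1%:R^-1.
  have t0 : 0 <= n.+1%:R * h w by rewrite mulr_ge0.
  rewrite gE -[X in X - _](@mulKf _ n.+1%:R)// -mulrBr normrM ger0_norm//.
  rewrite ler_piMr//; have /andP[le1 le2] := truncn_itv t0.
  by rewrite ger0_norm ?subr_ge0// lerBlDr addrC natr1 ltW.
have gK w : `|g w| <= n.+1%:R^-1 + K.
  rewrite -(subrK (h w) (g w)) (le_trans (ler_normD _ _))// lerD//.
  by rewrite distrC.
have ig := imul mg gK.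
have g0 : mean (fun w => g w * xi w) = 0.
  have -> : (fun w => g w * xi w) =
      (fun w => n.+1%:R^-1 * \sum_(i < N) \1_(B i) w * xi w).
    by apply/funext => w; rewrite /g -mulrA mulr_suml.
  have iB i : rintegrable (fun w => \1_(B i) w * xi w).
    apply: (imul (K := 1)); first exact/measurable_indic/F_meas.
    by move=> w; rewrite indicE ger0_norm// lern1 leq_b1.
  rewrite meanZ; last by apply: rintegrable_sum.
  by rewrite mean_sum// big1 ?mulr0// => i _; rewrite xi_null.
rewrite -[X in `|X|]subr0 -g0 -meanB//; last exact: imul hnK.
have E : (fun w => h w * xi w - g w * xi w) = (fun w => (h w - g w) * xi w).
  by apply/funext => w; rewrite mulrBl.
have id : rintegrable (fun w => (h w - g w) * xi w).
  by apply: imul hg; exact: measurable_funB.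
rewrite E (le_trans (mean_norm_le id))// -meanZ; last exact: rintegrable_norm.
apply: mean_le; [exact: rintegrable_norm|exact/rintegrableZ/rintegrable_norm|].
by apply: aeW => w; rewrite normrM ler_wpM2r.
Qed.

(** Clamping [h] to [-|K|, |K|] and adding |K| gives a function that is nonnegative and bounded
    everywhere, to which the previous case applies. The shift costs |K| times the mean of [xi],
    which is 0 by testing [xi] on the whole space. *)
Lemma mean_mul_null (h : T -> R) :
  (forall B, measurable B -> F (h @^-1` B)) -> essbounded h ->
  mean (fun w => h w * xi w) = 0.
Proof.
move=> Fh [mh [K hK]].
pose clamp (x : R) := Num.max 0 (Num.min (`|K| *+ 2) (x + `|K|)).
have mclamp : measurable_fun setT clamp.
  apply: measurable_maxr => //; apply: measurable_minr => //.
  exact: measurable_funD.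
have Fc : Fmeas (clamp \o h).
  move=> B mB; rewrite comp_preimage; apply: Fh.
  by rewrite -[X in measurable X]setTI; exact: mclamp.
have cK w : 0 <= (clamp \o h) w <= `|K| *+ 2.
  by rewrite /= /clamp le_max lexx /= ge_max ge_min lexx mulrn_wge0.
have hc : {ae Q, forall w, h w * xi w = clamp (h w) * xi w - `|K| * xi w}.
  apply: filterS hK => w /le_trans/(_ (ler_norm K)); rewrite ler_norml =>
    /andP[l1 l2].
  by rewrite /clamp min_r ?max_r; [ring|lra|rewrite mulr2n; lra].
have mxi := rintegrable_meas ixi.
have mc : measurable_fun setT (clamp \o h) by exact: measurableT_comp.
rewrite (mean_ae _ _ hc); last 2 first.
- exact: measurable_funM.
- by apply: measurable_funB; apply: measurable_funM.
rewrite meanB; last 2 first.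
- apply: (imul (K := `|K| *+ 2) mc) => w.
  by have /andP[c0 cK'] := cK w; rewrite ger0_norm.
- exact: rintegrableZ.
rewrite (mean_mul_ge0 Fc cK) meanZ// sub0r.
have -> : mean xi = 0.
  rewrite -(xi_null (Fh _ measurableT)); congr mean; apply/funext => w.
  by rewrite preimage_setT indicT mul1r.
by rewrite mulr0 oppr0.
Qed.

End Orthogonality.

End Expectation.

(** * Conditional expectation *)

Section SigmaAlgebra.
Context {R : realType} d (T : measurableType d).

Lemma sigma_measurableP (G : set (set T)) (V : T -> R) :
  (forall B, measurable B -> <<s G >> (V @^-1` B)) <->
  measurable_fun setT (V : g_sigma_algebraType G -> R).
Proof.
split=> [mV _ B mB|mV B mB]; first by rewrite setTI; exact: mV.
by rewrite -[_ @^-1` _]setTI; exact: mV.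
Qed.

Lemma sigma_mx_measurable p q (Y : T -> 'M[R]_(p, q)) :
  random_mx Y -> sigma_mx Y `<=` measurable.
Proof.
move=> mY; apply: smallest_sub; first exact: sigma_algebra_measurable.
by move=> _ [i [j [B [mB ->]]]]; rewrite -[_ @^-1` _]setTI; exact: mY.
Qed.

Lemma sigma_mx_entry p q (Y : T -> 'M[R]_(p, q)) i j B : measurable B ->
  sigma_mx Y ((fun w => Y w i j) @^-1` B).
Proof. by move=> mB; apply: sub_sigma_algebra; exists i, j, B. Qed.

Lemma sigma_algebra_setI (G : set (set T)) A B :
  <<s G >> A -> <<s G >> B -> <<s G >> (A `&` B).
Proof. exact: (@measurableI _ (g_sigma_algebraType G)). Qed.

Lemma sigma_algebraT (G : set (set T)) : <<s G >> setT.
Proof. exact: (@measurableT _ (g_sigma_algebraType G)). Qed.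

End SigmaAlgebra.

Section CondExp.
Context {R : realType} d (T : measurableType d) (Q : probability T R).
Variable G : set (set T).
Hypothesis G_meas : <<s G >> `<=` measurable.
Local Notation condexp := (is_condexp Q <<s G >>).
Implicit Types X Y V U : T -> R.

Lemma mean_indicE A X : mean Q (fun w => \1_A w * X w) = \int[Q]_(w in A) X w.
Proof.
rewrite Rintegral_mkcond; congr Rintegral; apply/funext => w.
by rewrite /patch indicE; case: (w \in A); rewrite ?mul1r ?mul0r.
Qed.

Lemma rintegrable_indicM A X : measurable A -> rintegrable Q X ->
  rintegrable Q (fun w => \1_A w * X w).
Proof.
move=> mA iX; apply: (rintegrable_le (Y := fun w => `|X w|)).
- by apply: measurable_funM => //; exact: rintegrable_meas iX.
- exact: rintegrable_norm.
- by move=> w; rewrite normrM indicE; case: (_ \in _); rewrite ?normr1 ?mul1r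
  ?normr0 ?mul0r.
Qed.

Lemma condexp_mean Y V A : condexp Y V -> <<s G >> A ->
  mean Q (fun w => \1_A w * V w) = mean Q (fun w => \1_A w * Y w).
Proof. by move=> [_ _ _ h] GA; rewrite !mean_indicE; congr fine; exact: h. Qed.

Lemma condexp_meanT Y V : condexp Y V -> mean Q V = mean Q Y.
Proof.
move=> /condexp_mean/(_ (sigma_algebraT (G := G))).
have E X : mean Q (fun w => \1_setT w * X w) = mean Q X.
  by congr mean; apply/funext => w; rewrite indicT mul1r.
by rewrite !E.
Qed.

Lemma condexp_mean_null Y V B : condexp Y V -> <<s G >> B ->
  mean Q (fun w => \1_B w * (Y w - V w)) = 0.
Proof.
move=> cY GB; have [iY _ iV _] := cY.
have mB := G_meas GB.
under [X in mean Q X]eq_fun do rewrite mulrBr.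
by rewrite meanB ?(condexp_mean cY GB) ?subrr//; exact: rintegrable_indicM.
Qed.

(** The set where V' < V belongs to the sub-sigma-algebra. Testing both conditional expectations on
    it shows that V - V', positive there, has integral at most 0 over it, so the set is null. *)
Lemma condexp_le Y Y' V V' : condexp Y V -> condexp Y' V' ->
  {ae Q, forall w, Y w <= Y' w} -> {ae Q, forall w, V w <= V' w}.
Proof.
move=> cY cY' le; have [iY mV iV _] := cY; have [iY' mV' iV' _] := cY'.
pose A := [set w | V' w < V w].
have GA : <<s G >> A.
  have := measurable_fun_ltr ((sigma_measurableP G V').1 mV')
                             ((sigma_measurableP G V).1 mV).
  move=> /(_ measurableT [set true]) /(_ I); rewrite setTI.
  by rewrite (_ : _ @^-1` _ = A).
have mA := G_meas GA.
pose X w := \1_A w * (V w - V' w).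
have iX : rintegrable Q X by apply: rintegrable_indicM => //; exact:
  rintegrableB.
have X0 w : 0 <= X w.
  rewrite /X indicE; case: (boolP (w \in A)); last by rewrite mul0r.
  by rewrite inE mul1r subr_ge0 => /ltW.
have EX : mean Q X = 0.
  apply/eqP; rewrite eq_le; apply/andP; split; last first.
    rewrite -(mean_cst Q 0); apply: mean_le => //; first exact: rintegrable_cst.
    exact: aeW.
  have -> : X = (fun w => \1_A w * V w - \1_A w * V' w).
    by apply/funext => w; rewrite /X mulrBr.
  rewrite meanB; [|exact: rintegrable_indicM..].
  rewrite (condexp_mean cY)// (condexp_mean cY')// subr_le0.
  apply: mean_le; [exact: rintegrable_indicM..|].
  by apply: filterS le => w le; rewrite ler_wpM2l.
apply: filterS (mean_eq0_ae iX X0 EX) => w; rewrite /X indicE.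
have [wA|wA] := boolP (w \in A).
  by move=> /eqP; rewrite mul1r subr_eq0 => /eqP ->.
by move: wA; rewrite notin_setE /A /= => /negP; rewrite -leNgt.
Qed.

Lemma condexp_unique Y V V' : condexp Y V -> condexp Y V' ->
  {ae Q, forall w, V w = V' w}.
Proof.
move=> cV cV'; have le : {ae Q, forall w, Y w <= Y w} by exact: aeW.
apply: filterS2 (condexp_le cV cV' le) (condexp_le cV' cV le) => w le1 le2.
by apply/eqP; rewrite eq_le le1 le2.
Qed.

Lemma condexp_affine Y V h a : condexp Y V ->
  (forall B, measurable B -> <<s G >> (h @^-1` B)) -> rintegrable Q h ->
  condexp (fun w => a * Y w + h w) (fun w => a * V w + h w).
Proof.
move=> cY mh ih; have [iY mV iV e] := cY.
have iaY : rintegrable Q (fun w => a * Y w + h w).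
  by apply: rintegrableD => //; exact: rintegrableZ.
have iaV : rintegrable Q (fun w => a * V w + h w).
  by apply: rintegrableD => //; exact: rintegrableZ.
split=> // [|A GA].
  apply/sigma_measurableP; apply: measurable_funD; last exact/sigma_measurableP.
  by apply: measurable_funM => //; exact/sigma_measurableP.
have mA := G_meas GA.
have intA X : rintegrable Q X -> Q.-integrable A (EFin \o X).
  by move=> iX; apply: integrableS iX.
rewrite -[LHS]fineK; last exact: integrable_fin_num (intA _ iaV).
rewrite -[RHS]fineK; last exact: integrable_fin_num (intA _ iaY).
congr EFin; rewrite -[LHS]/(Rintegral Q A _) -[RHS]/(Rintegral Q A _).
rewrite !RintegralD//; try exact: intA; try exact/intA/rintegrableZ.
rewrite !RintegralZl//; try exact: intA.
by congr (_ * _ + _); congr fine; exact: e.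
Qed.

(** Radon-Nikodym on the sub-sigma-algebra: the charge with density [Y] and the probability [Q] are
    both transported along the identity [phi] to the type whose measurable sets are [<<s G >>], so
    the density obtained there has the required measurability. *)
Lemma condexp_exists Y : rintegrable Q Y -> exists V, condexp Y V.
Proof.
move=> iY.
pose phi (w : T) : g_sigma_algebraType G := w.
have mphi : measurable_fun setT phi.
  by move=> _ B mB; rewrite setTI; exact: G_meas.
pose nu' : {charge set (g_sigma_algebraType G) -> \bar R} :=
  pushforward (induced_charge iY) phi.
pose nu := nu' mphi.
pose mphi' : {mfun T >-> g_sigma_algebraType G} :=
  HB.pack phi (isMeasurableFun.Build _ _ _ _ phi mphi).
pose mu := distribution Q mphi'.
have numu : nu `<< mu.
  apply/null_content_dominatesP => A mA muA; apply: null_set_integral => //.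
    exact: G_meas.
  by apply: measurable_funTS; exact: measurable_int iY.
pose f := Radon_Nikodym nu mu.
have ff w : f w = (fine (f w))%:E by rewrite fineK// Radon_Nikodym_fin_num.
have intf : mu.-integrable setT f by exact: Radon_Nikodym_integrable.
have mf : measurable_fun setT f := measurable_int _ intf.
have mV : measurable_fun setT (fine \o f : g_sigma_algebraType G -> R).
  by apply: measurableT_comp mf; exact: fine_measurable.
have mfT : measurable_fun setT (f \o phi) by exact: measurableT_comp.
have intfQ : Q.-integrable setT (f \o phi).
  apply/integrableP; split=> //.
  have /integrableP[_] := intf; apply: le_lt_trans.
  rewrite [leRHS](ge0_integral_pushforward mphi)//.
  by apply: measurableT_comp.
have EV : EFin \o (fine \o f : T -> R) = f \o phi.
  by apply/funext => w /=; rewrite -ff.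
exists (fine \o f); split=> //.
- exact/sigma_measurableP.
- by rewrite EV.
- move=> A GA.
  rewrite [LHS](_ : _ = \int[Q]_(w in A) (f \o phi) w)%E; last first.
    by apply: eq_integral => w _; rewrite /= -ff.
  rewrite -(integral_pushforward mphi (D := A) mf)//; last first.
    by apply: integrableS intfQ => //; exact: G_meas.
  by rewrite -[RHS]/(nu A) (Radon_Nikodym_integral numu).
Qed.

End CondExp.

(** * Orthogonality from conditional independence *)

Section CondIndep.
Context {R : realType} d (T : measurableType d) (Q : probability T R).
Variables G F1 F2 : set (set T).
Hypotheses (G_meas : <<s G >> `<=` measurable).
Hypotheses (F1_meas : <<s F1 >> `<=` measurable).
Hypotheses (F2_meas : <<s F2 >> `<=` measurable).
Local Notation condexp := (is_condexp Q <<s G >>).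

Lemma condexp_id h : (forall B, measurable B -> <<s G >> (h @^-1` B)) ->
  rintegrable Q h -> condexp h h.
Proof. by move=> mh ih; split. Qed.

Lemma condexp_cst (a : R) : condexp (fun=> a) (fun=> a).
Proof.
apply: condexp_id; last exact: rintegrable_cst.
exact/sigma_measurableP/measurable_cst.
Qed.

Lemma condexp_essbounded Y V : condexp Y V -> essbounded Q Y -> essbounded Q V.
Proof.
move=> cY [mY [K YK]]; have [_ _ iV _] := cY.
split; first exact: rintegrable_meas iV.
have le1 : {ae Q, forall w, Y w <= K}.
  by apply: filterS YK => w; rewrite ler_norml => /andP[].
have le2 : {ae Q, forall w, - K <= Y w}.
  by apply: filterS YK => w; rewrite ler_norml => /andP[].
exists K; apply: filterS2 (condexp_le G_meas cY (condexp_cst K) le1)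
  (condexp_le G_meas (condexp_cst (- K)) cY le2) => w h1 h2.
by rewrite ler_norml h2.
Qed.

Let indicM_preimage A (h : T -> R) : <<s G >> A ->
  (forall B, measurable B -> <<s G >> (h @^-1` B)) ->
  forall B, measurable B -> <<s G >> ((fun w => \1_A w * h w : R) @^-1` B).
Proof.
move=> GA mh; apply/sigma_measurableP; apply: measurable_funM.
  exact: measurable_indic.
exact/sigma_measurableP.
Qed.

Hypothesis indep : cond_independent Q <<s G >> <<s F1 >> <<s F2 >>.
Variables (eta V : T -> R).
Hypothesis eta_meas : forall B, measurable B -> <<s F2 >> (eta @^-1` B).
Hypothesis eta_bounded : essbounded Q eta.
Hypothesis etaV : condexp eta V.

Let V_bounded : essbounded Q V.
Proof. exact: condexp_essbounded etaV eta_bounded. Qed.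

(** With u a conditional probability of A, 1_A 1_C (eta - V) is the sum of eta 1_C (1_A - u), of -
    1_C V (1_A - u) and of 1_C u (eta - V). The last two have mean 0 because their multipliers are
    measurable for the conditioning; only the first uses independence. *)
Lemma cond_independent_mean A C : <<s F1 >> A -> <<s G >> C ->
  mean Q (fun w => \1_(A `&` C) w * (eta w - V w)) = 0.
Proof.
move=> FA GC; have [_ mV _ _] := etaV.
have mA := F1_meas FA; have mC := G_meas GC.
have bA : essbounded Q (\1_A : T -> R) by exact: essbounded_indic.
have bC : essbounded Q (\1_C : T -> R) by exact: essbounded_indic.
have [u cu] := condexp_exists G_meas (essbounded_integrable bA).
have bu := condexp_essbounded cu bA; have [_ mu _ _] := cu.
have e1 : mean Q (fun w => eta w * (\1_C w * (\1_A w - u w))) = 0.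
  apply: (mean_mul_null (F := <<s F2 >>)) => //.
    by apply/essbounded_integrable/essboundedM => //; exact: essboundedB.
  move=> B FB; have mB := F2_meas FB.
  have bB : essbounded Q (\1_B : T -> R) by exact: essbounded_indic.
  (* Independence supplies a version [u'] that may change with [B]; uniqueness of conditional
     expectations identifies it with the [u] fixed beforehand. *)
  have [u' [v [cu' cv cuv]]] := indep FA FB.
  have bv := condexp_essbounded cv bB.
  have z : mean Q (fun w => \1_C w * u w * (\1_B w - v w)) = 0.
    apply: (mean_mul_null (F := <<s G >>)) => //.
    - by apply/essbounded_integrable/essboundedB.
    - by move=> D GD; exact: condexp_mean_null cv GD.
    - exact: indicM_preimage.
    - exact: essboundedM.
  have y : mean Q (fun w => \1_C w * (u w * v w)) =
           mean Q (fun w => \1_C w * \1_(A `&` B) w).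
    rewrite -(condexp_mean cuv GC); apply: mean_ae.
    - by have [] := essboundedM bC (essboundedM bu bv).
    - have [_ _ /rintegrable_meas m _] := cuv.
      by apply: measurable_funM => //; exact: measurable_indic.
    - by apply: filterS (condexp_unique G_meas cu cu') => w ->.
  have -> : (fun w => \1_B w * (\1_C w * (\1_A w - u w))) =
      (fun w => \1_C w * \1_(A `&` B) w - \1_C w * (u w * v w) -
                \1_C w * u w * (\1_B w - v w)) :> (T -> R).
    by apply/funext => w; rewrite indicI /=; ring.
  have bAB : essbounded Q (\1_(A `&` B) : T -> R).
    by apply: essbounded_indic; exact: measurableI.
  rewrite !meanB ?y ?z ?subrr ?subr0//; apply: essbounded_integrable.
  - exact: essboundedM.
  - by apply: essboundedM => //; exact: essboundedM.
  - by apply: essboundedB; apply: essboundedM => //; exact: essboundedM.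
  - by apply: essboundedM; [exact: essboundedM|exact: essboundedB].
have e2 : mean Q (fun w => (\1_C w * V w) * (\1_A w - u w)) = 0.
  apply: (mean_mul_null (F := <<s G >>)) => //.
  - by apply/essbounded_integrable/essboundedB.
  - by move=> D GD; exact: condexp_mean_null cu GD.
  - exact: indicM_preimage.
  - exact: essboundedM.
have e3 : mean Q (fun w => (\1_C w * u w) * (eta w - V w)) = 0.
  apply: (mean_mul_null (F := <<s G >>)) => //.
  - by apply/essbounded_integrable/essboundedB.
  - by move=> D GD; exact: condexp_mean_null etaV GD.
  - exact: indicM_preimage.
  - exact: essboundedM.
have -> : (fun w => \1_(A `&` C) w * (eta w - V w)) =
   (fun w => eta w * (\1_C w * (\1_A w - u w)) - (\1_C w * V w) * (\1_A w - u w)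
       + (\1_C w * u w) * (eta w - V w)).
  by apply/funext => w; rewrite indicI /=; ring.
have b1 : essbounded Q (fun w => eta w * (\1_C w * (\1_A w - u w))).
  by apply: essboundedM => //; apply: essboundedM => //; exact: essboundedB.
have b2 : essbounded Q (fun w => (\1_C w * V w) * (\1_A w - u w)).
  by apply: essboundedM; [exact: essboundedM|exact: essboundedB].
have b3 : essbounded Q (fun w => (\1_C w * u w) * (eta w - V w)).
  by apply: essboundedM; [exact: essboundedM|exact: essboundedB].
rewrite meanD ?meanB ?e1 ?e2 ?e3 ?subrr ?addr0//; apply: essbounded_integrable
  => //.
exact: essboundedB.
Qed.

(** Intersections rather than the union of the two sigma-algebras: this family generates the same
    join and is a pi-system, as the Dynkin argument requires. *)
Definition join_gen : set (set T) :=
  [set D | exists A C, [/\ <<s F1 >> A, <<s G >> C & D = A `&` C]].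

Lemma join_gen_meas : <<s join_gen >> `<=` measurable.
Proof.
apply: smallest_sub; first exact: sigma_algebra_measurable.
by move=> _ [A [C [FA GC ->]]]; apply: measurableI; [exact: F1_meas|exact:
  G_meas].
Qed.

Lemma sub_join_l : <<s F1 >> `<=` <<s join_gen >>.
Proof.
move=> A FA; apply: sub_sigma_algebra; exists A, setT; split=> //.
  exact: sigma_algebraT.
by rewrite setIT.
Qed.

Lemma sub_join_r : <<s G >> `<=` <<s join_gen >>.
Proof.
move=> C GC; apply: sub_sigma_algebra; exists setT, C; split=> //.
  exact: sigma_algebraT.
by rewrite setTI.
Qed.

(** Pi-lambda argument for the charge [nu] with density eta - V. The measurable sets of zero charge
    contain the rectangles by [cond_independent_mean], and the whole space being one of these gives
    closure under complements. *)
Let join_null D : <<s join_gen >> D ->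
  mean Q (fun w => \1_D w * (eta w - V w)) = 0.
Proof.
move=> JD.
have ixi : rintegrable Q (fun w => eta w - V w).
  by apply/essbounded_integrable/essboundedB.
pose nu := induced_charge ixi.
have nuE A : mean Q (fun w => \1_A w * (eta w - V w)) = fine (nu A).
  by rewrite mean_indicE.
have nuK A : measurable A -> fine (nu A) = 0 -> nu A = 0%E.
  by move=> mA h; rewrite -[LHS]fineK ?h// fin_num_measure.
have nuT : nu setT = 0%E.
  apply: nuK => //; rewrite -nuE -[setT]setIT.
  by apply: cond_independent_mean; exact: sigma_algebraT.
suff [mD nuD] : measurable D /\ nu D = 0%E by rewrite nuE nuD.
suff : <<s join_gen >> `<=` [set D | measurable D /\ nu D = 0%E] by apply.
apply: lambda_system_subset => //.
- move=> _ _ [A [C [FA GC ->]]] [A' [C' [FA' GC' ->]]].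
  exists (A `&` A'), (C `&` C'); split.
  + exact: (sigma_algebra_setI FA FA').
  + exact: (sigma_algebra_setI GC GC').
  + by rewrite setIACA.
- apply/dynkin_lambda_system; split=> //.
  + move=> B [mB nuB]; split; first exact: measurableC.
    have E : nu (B `|` ~` B) = (nu B + nu (~` B))%E.
      exact: chargeU mB (measurableC mB) (setICr B).
    by move: E; rewrite setUCr nuT nuB add0e.
  + move=> F tF F0; have mF k : measurable (F k) by have [] := F0 k.
    have mUF : measurable (\bigcup_k F k) by exact: bigcupT_measurable.
    have cv : (fun n => (\sum_(0 <= i < n) nu (F i))%E) @ \oo --> nu (\bigcup_k
      F k).
      exact: charge_semi_sigma_additive mF tF mUF.
    have E : (fun n => (\sum_(0 <= i < n) nu (F i))%E) = cst 0%E.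
      by apply/funext => n; rewrite big1// => i _; have [] := F0 i.
    rewrite E in cv; split=> //.
    exact: (cvg_unique (@ereal_hausdorff R) cv (@cvg_cst _ 0%E _ _ _)).
- move=> _ [A [C [FA GC ->]]]; have mAC : measurable (A `&` C).
    by apply: measurableI; [exact: F1_meas|exact: G_meas].
  by split=> //; apply: nuK => //; rewrite -nuE; exact: cond_independent_mean.
Qed.

(** The multiplier may depend jointly on the conditioning variables and on [F1], as the inverse KKT
    matrix depends on iterates and Hessian. *)
Lemma cond_independent_orthogonal h :
  measurable_fun setT (h : g_sigma_algebraType join_gen -> R) ->
  essbounded Q h -> mean Q (fun w => h w * (eta w - V w)) = 0.
Proof.
move=> mh bh; apply: (mean_mul_null join_gen_meas) => //.
- by apply/essbounded_integrable/essboundedB.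
- exact/sigma_measurableP.
Qed.

End CondIndep.

(** * One step of the algorithm *)

Section MeritStep.
Context {R : realType} {n m N : nat}.
Variables (X : set 'cV[R]_n) (f : 'I_N -> 'cV[R]_n -> R).
Variables (c : 'cV[R]_n -> 'cV[R]_m) (L : R) (gam : 'I_m -> R).
Hypothesis sp : smooth_problem X f c L gam.
Hypothesis N_gt0 : (0 < N)%N.

Let f_diff i x : differentiable (f i) x. Proof. by have [] := f_C1 sp i. Qed.

Let c_diff i x : differentiable (constr c i) x.
Proof. by have [] := c_C1 sp i. Qed.

Lemma jac_mulE x (v : 'cV[R]_n) i :
  (jac c x *m v) i 0 = dotv (grad (constr c i) x) v.
Proof. by rewrite mxE; apply: eq_bigr => j _; rewrite mxE. Qed.

(** As J v = - c, the linearised constraint after the step is (1 - alpha) c, with a nonnegative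
    factor. The second-order errors of the objective and of each constraint add up to the
    coefficient tau L + sum of the [gam i]. *)
Lemma merit_step (tau alpha : R) x v : 0 <= tau -> 0 <= alpha <= 1 ->
  jac c x *m v = - c x ->
  merit f c (x + alpha *: v) tau <= merit f c x tau
    - alpha * model_reduction (c x) tau (grad (favg f) x) v
    + alpha ^+ 2 * (tau * L + \sum_i gam i) / 2 * dotv v v.
Proof.
move=> tau0 /andP[a0 a1] Jv.
have fle : favg f (x + alpha *: v) <= favg f x
    + alpha * dotv (grad (favg f) x) v + L / 2 * (alpha ^+ 2 * dotv v v).
  have := taylor_lipschitz_grad x (alpha *: v) (differentiable_favg f_diff)
    (lipschitz_grad_favg f_diff (f_lip sp) N_gt0).
  rewrite sqr_l2norm !dotvZl !dotvZr => /(le_trans (ler_norm _)).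
  by lra.
have cle i : `|c (x + alpha *: v) i 0| <= (1 - alpha) * `|c x i 0|
    + gam i / 2 * (alpha ^+ 2 * dotv v v).
  have := taylor_lipschitz_grad x (alpha *: v) (c_diff i) (c_lip sp i).
  rewrite sqr_l2norm !dotvZl !dotvZr -jac_mulE Jv mxE /constr [alpha * (_ *
    _)]mulrA -expr2.
  set y := c (x + alpha *: v) i 0; set z := c x i 0 => le.
  rewrite -[1 - alpha]ger0_norm ?subr_ge0// -normrM.
  have -> : y = (1 - alpha) * z + (y - z - alpha * - z) by ring.
  by rewrite (le_trans (ler_normD _ _))// lerD2l.
have l1le : l1norm (c (x + alpha *: v)) <= (1 - alpha) * l1norm (c x)
    + (\sum_i gam i) / 2 * (alpha ^+ 2 * dotv v v).
  rewrite (le_trans (ler_sum _ (fun i _ => cle i)))// big_split /=.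
  by rewrite -mulr_sumr -!mulr_suml.
rewrite /merit /model_reduction.
have := ler_wpM2l tau0 fle; move: l1le.
set q := dotv v v; set a2 := alpha ^+ 2; set s := \sum_i gam i.
set F := favg f x; set F' := favg f _; set gv := dotv _ v.
set l := l1norm (c x); set l' := l1norm _ => h1 h2.
have -> : tau * F + l - alpha * (- tau * gv + l) + a2 * (tau * L + s) / 2 * q =
  tau * (F + alpha * gv + L / 2 * (a2 * q)) + ((1 - alpha) * l + s / 2 * (a2 *
    q)).
  by field.
exact: lerD.
Qed.

End MeritStep.

(** The first KKT row turns the Lagrangian gradient into - H v, and |v|^2 is controlled by the model
    reduction. For the constraint part, tau below its trial value makes the reduction at least sigma
    times the 1-norm of [cx]: directly if the denominator is at most 0, by the ratio test
    otherwise. *)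
Lemma kkt_residual_bound (R : realType) n m (H : 'M[R]_n) (J : 'M[R]_(m, n))
    (g v : 'cV[R]_n) (cx y : 'cV[R]_m) (tau sigma kl kH : R) :
  0 < tau -> 0 < sigma < 1 -> 0 < kl -> 0 < kH ->
  kkt_mx H J *m col_mx v y = - col_mx g cx -> opnorm2 H <= kH ->
  (tau%:E <= tau_trial sigma H cx g v)%E ->
  kl * tau * l2norm v ^+ 2 <= model_reduction cx tau g v ->
  l2norm (g + J^T *m y) ^+ 2 / kH ^+ 2 + l2norm cx <=
    ((kl * tau)^-1 + sigma^-1) * model_reduction cx tau g v.
Proof.
move=> tau0 /andP[s0 s1] kl0 kH0; rewrite kkt_mxE opp_col_mx => /eq_col_mx[Kg
  _].
move=> Hle tt le.
have kt : 0 < kl * tau by rewrite mulr_gt0.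
rewrite mulrDl; apply: lerD.
  rewrite mulrC -[leRHS]mulrC; apply: (@le_trans _ _ (l2norm v ^+ 2)); last
    first.
    by rewrite ler_pdivlMr// mulrC.
  rewrite mulrC ler_pdivrMr ?exprn_gt0//.
  have -> : g + J^T *m y = - (H *m v).
    by apply/eqP; rewrite -addr_eq0 -addrA (addrC _ (H *m v)) Kg subrr.
  rewrite l2normN -exprMn lerXn2r ?nnegrE ?mulr_ge0 ?l2norm_ge0 ?(ltW kH0)//.
  by rewrite (le_trans (opnorm2P _ _))// mulrC ler_wpM2l// l2norm_ge0.
rewrite mulrC ler_pdivlMr// mulrC; apply: (@le_trans _ _ (sigma * l1norm cx)).
  by rewrite ler_wpM2l ?(ltW s0)// l2norm_le_l1norm.
rewrite /model_reduction; move: tt; rewrite /tau_trial.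
have l0 : 0 <= l1norm cx := l1norm_ge0 _.
have gle : dotv g v <= trial_denominator H g v by rewrite lerDl le_max lexx
  orbT.
case: ifPn => [t0 _|]; first by nra.
rewrite -ltNge => t0; rewrite lee_fin ler_pdivlMr// => t1; nra.
Qed.

Lemma cond_prob_ae (R : realType) d (T : measurableType d) (P : probability T R)
    (E : set T) (mE : measurable E) : (0 < P E)%E ->
  {ae cond_prob P mE, forall w, E w}.
Proof.
move=> PE; exists (~` E); split=> //; first exact: measurableC.
rewrite /cond_prob /= /mnormalize /= /mrestr setTI.
have fE : P E \is a fin_num by exact: fin_num_measure.
rewrite gt_eqF//= lt_eqF ?ltey_eq ?fE//.
by rewrite setICl measure0 mul0e.
Qed.

Lemma quadratic_growth_bound (R : realType) (a e h x : R) : 0 < a -> 0 <= e ->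
  0 <= h -> 0 <= x -> a * x ^+ 2 <= e * x + h -> x <= 1 + (e + h) / a.
Proof.
move=> a0 e0 h0 x0 le; case: (leP x 1) => x1.
  by rewrite (le_trans x1)// lerDl divr_ge0 ?addr_ge0// ltW.
rewrite (@le_trans _ _ ((e + h) / a))//; last by rewrite lerDr.
rewrite ler_pdivlMr//; nra.
Qed.

(** * Analysis of a run *)

Section Process.
Context {R : realType} {n m N b S : nat}.
Context {d : measure_display} {T : measurableType d}.
Variables (L Gam taumin kl kH zeta sigma : R).
Variables (X : set 'cV[R]_n) (f : 'I_N -> 'cV[R]_n -> R).
Variables (c : 'cV[R]_n -> 'cV[R]_m) (gam : 'I_m -> R).
Variables (P : probability T R) (p : sqp_process R T n m N).
Variables (x0 : 'cV[R]_n) (tau0 eps alpha : R) (kbar : nat).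
Hypothesis mE : measurable (merit_event f c S p sigma kbar taumin).

Let E := merit_event f c S p sigma kbar taumin.
Let Q := cond_prob P mE.

Hypothesis L_ge0 : 0 <= L.
Hypothesis taumin_gt0 : 0 < taumin.
Hypothesis kl_gt0 : 0 < kl.
Hypothesis kH_gt0 : 0 < kH.
Hypothesis zeta_gt0 : 0 < zeta.
Hypothesis sigma01 : 0 < sigma < 1.
Hypothesis b_gt0 : (0 < b)%N.
Hypothesis N_gt0 : (0 < N)%N.
Hypothesis sp : smooth_problem X f c L gam.
Hypothesis gamE : \sum_(i < m) gam i = Gam.
Hypothesis rp : random_process S p.
Hypothesis run : sqp_run f c b S p x0 tau0 eps sigma alpha.
Hypothesis itrX : forall k s w, (s <= S)%N -> X (itr p k s w).
Hypothesis det : deterministic_counterpart f c S p.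
Hypothesis ha : hess_assumption c S p kH zeta.
Hypothesis PE : (0 < P E)%E.
Hypothesis ge : gradient_estimates f b S p Q L.
Hypothesis mrb : model_reduction_bound f c b S p E kl.
Hypothesis alpha01 : 0 < alpha <= 1.

Let f_diff i x : differentiable (f i) x. Proof. by have [] := f_C1 sp i. Qed.

Let favg_diff x : differentiable (favg f) x.
Proof. exact: differentiable_favg. Qed.

Let favg_lip : lipschitz_grad L (favg f).
Proof. exact: lipschitz_grad_favg f_diff (f_lip sp) N_gt0. Qed.

Lemma ae_merit_event : {ae Q, forall w, E w}.
Proof. exact: cond_prob_ae. Qed.

Definition g_err k s w := gbar f b p k s w - g_at f p k s w.
Definition d_err k s w := dbar p k s w - dtrue p k s w.
Definition y_err k s w := ybar p k s w - ytrue p k s w.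
Definition itr_dev k s w := itr p k s w - itr p k 0%N w.
Definition reduction k s w :=
  model_reduction (c_at c p k s w) taumin (g_at f p k s w) (dtrue p k s w).

Lemma K_unit k s w : (s < S)%N -> K_at c p k s w \in unitmx.
Proof.
move=> sS; apply: (kkt_unit zeta_gt0) => [u Ju|J0].
  exact: (hess_curv ha sS Ju).
have [kJ kJ0 sv] := J_singular sp.
by have := sv _ _ (itrX k w (ltnW sS)) J0; rewrite leNgt kJ0.
Qed.

(** The two linear systems have the same matrix and the same constraint block, so subtraction leaves
    only the gradient error. *)
Lemma K_err k s w : (s < S)%N ->
  K_at c p k s w *m col_mx (d_err k s w) (y_err k s w) = col_mx (- g_err k s w)
    0.
Proof.
move=> sS; have -> : col_mx (d_err k s w) (y_err k s w) =
    col_mx (dbar p k s w) (ybar p k s w) - col_mx (dtrue p k s w) (ytrue p k s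
      w).
  by rewrite opp_col_mx add_col_mx.
rewrite mulmxBr (run_solve run)// det// opprK addrC opp_col_mx add_col_mx.
by rewrite /g_err opprB subrr.
Qed.

Lemma J_dbar k s w : (s < S)%N ->
  J_at c p k s w *m dbar p k s w = - c_at c p k s w.
Proof.
move=> sS; have := run_solve run k w sS.
by rewrite /K_at kkt_mxE opp_col_mx => /eq_col_mx[].
Qed.

Lemma itr_succ k s w : (s < S)%N ->
  itr p k s.+1 w = itr p k s w + alpha *: dbar p k s w.
Proof.
move=> sS; have [d0|d0] := eqVneq (dbar p k s w) 0.
  by have [-> _] := run_null run sS d0; rewrite d0 scaler0 addr0.
by have [-> _] := run_step run sS d0.
Qed.

Lemma dot_err_bound k s w : (s < S)%N ->
  - dotv (g_err k s w) (d_err k s w) <= l2norm (g_err k s w) ^+ 2 / zeta.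
Proof.
move=> sS; have Kq := K_err k w sS.
have := kkt_bound zeta_gt0 (fun u => hess_curv ha sS) Kq.
rewrite l2normN => le.
have := norm_dotv_le (g_err k s w) (d_err k s w); rewrite ler_norml => /andP[h
  _].
by rewrite lerNl (le_trans _ h)// lerN2 expr2 -mulrA ler_wpM2l// l2norm_ge0.
Qed.

Section Tail.
Variable k : nat.
Hypothesis k_ge : (kbar <= k)%N.

Lemma merit_event_tau s w : (s < S)%N -> E w -> taubar p k s w = taumin.
Proof. by move=> sS Ew; have [] := Ew k s k_ge sS. Qed.

Lemma reduction_ge s w : (s < S)%N -> E w ->
  kl * taumin * l2norm (dtrue p k s w) ^+ 2 <= reduction k s w.
Proof.
by move=> sS Ew; have [+ _] := mrb k sS Ew; rewrite merit_event_tau.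
Qed.

(** Of the four products in [gbar . dbar], [g_err . d_err] is quadratic in the error and bounded
    through [zeta]. The two that are linear in the error are kept exactly, since they vanish only in
    mean. *)
Lemma reduction_dbar s w : (s < S)%N -> E w ->
  kl * taumin * dotv (dbar p k s w) (dbar p k s w) <=
    reduction k s w + taumin / zeta * l2norm (g_err k s w) ^+ 2
      - taumin * dotv (g_err k s w) (dtrue p k s w)
      - taumin * dotv (g_at f p k s w) (d_err k s w).
Proof.
move=> sS Ew; have [_] := mrb k sS Ew; rewrite merit_event_tau// sqr_l2norm.
have := dot_err_bound k w sS; rewrite /reduction /model_reduction.
have -> : dotv (gbar f b p k s w) (dbar p k s w) =
  dotv (g_at f p k s w) (dtrue p k s w) + dotv (g_err k s w) (d_err k s w) +
  dotv (g_err k s w) (dtrue p k s w) + dotv (g_at f p k s w) (d_err k s w).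
  by rewrite /g_err /d_err !(dotvBl, dotvDr, dotvNr); ring.
move=> /(ler_wpM2l (ltW taumin_gt0)); rewrite mulrCA mulrA (mulrC (_ ^+ 2))
  mulrA.
lra.
Qed.

Lemma merit_itr_succ s w : (s < S)%N ->
  merit f c (itr p k s.+1 w) taumin <= merit f c (itr p k s w) taumin
    - alpha * reduction k s w
    - alpha * taumin * - dotv (g_at f p k s w) (d_err k s w)
    + alpha ^+ 2 * (taumin * L + Gam) / 2 * dotv (dbar p k s w) (dbar p k s w).
Proof.
move=> sS; rewrite itr_succ// -gamE.
have a01 : 0 <= alpha <= 1 by case/andP: alpha01 => /ltW -> ->.
apply: (le_trans (merit_step sp N_gt0 (ltW taumin_gt0) a01 (J_dbar k w sS))).
rewrite lerD2r /reduction /model_reduction /d_err dotvDr dotvNr.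
rewrite le_eqVlt; apply/orP; left; apply/eqP; rewrite /g_at /c_at; ring.
Qed.

(** Young's inequality with weight [z] is spent only on the product with [dtrue], whose square the
    reduction controls. The product with [d_err] is left exact, to be averaged away. *)
Lemma itr_dev_succ z s w : 0 < z -> (s < S)%N -> E w ->
  dotv (itr_dev k s.+1 w) (itr_dev k s.+1 w) <=
    (1 + alpha * z) * dotv (itr_dev k s w) (itr_dev k s w)
    + alpha / (z * (kl * taumin)) * reduction k s w
    + 2 * alpha * dotv (itr_dev k s w) (d_err k s w)
    + alpha ^+ 2 * dotv (dbar p k s w) (dbar p k s w).
Proof.
move=> z0 sS Ew; have /andP[a0 _] := alpha01.
have kt : 0 < kl * taumin by rewrite mulr_gt0.
have -> : itr_dev k s.+1 w = itr_dev k s w + alpha *: dbar p k s w.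
  by rewrite /itr_dev itr_succ// addrAC.
set v := itr_dev k s w; set db := dbar p k s w; set dt := dtrue p k s w.
have -> : dotv (v + alpha *: db) (v + alpha *: db) =
  dotv v v + 2 * alpha * dotv v dt + 2 * alpha * dotv v (d_err k s w) +
    alpha ^+ 2 * dotv db db.
  rewrite /d_err -/db -/dt; clearbody v db dt.
  by rewrite !(dotvDl, dotvDr, dotvNr, dotvZl, dotvZr) (dotvC db v); ring.
rewrite lerD2r lerD2r [X in _ <= X + _]mulrDl mul1r -[leRHS]addrA lerD2l.
have le1 : 2 * dotv v dt <= z * dotv v v + z^-1 * dotv dt dt.
  clearbody v dt; have := dotvv_ge0 (z *: v - dt).
  rewrite !(dotvDl, dotvDr, dotvNl, dotvNr, dotvZl, dotvZr) (dotvC dt v) => h.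
  have {h} : 0 <= z^-1 * (z * (z * dotv v v) - z * dotv v dt - (z * dotv v dt -
    dotv dt dt)).
    by rewrite mulr_ge0 ?invr_ge0 ?(ltW z0)//; move: h; lra.
  have -> : z^-1 * (z * (z * dotv v v) - z * dotv v dt - (z * dotv v dt - dotv
    dt dt)) =
    z * dotv v v - 2 * dotv v dt + z^-1 * dotv dt dt.
    by field; rewrite gt_eqF.
  by lra.
have le2 : dotv dt dt <= reduction k s w / (kl * taumin).
  by rewrite ler_pdivlMr// mulrC -sqr_l2norm; exact: reduction_ge.
have -> : alpha / (z * (kl * taumin)) * reduction k s w =
  alpha * (z^-1 * (reduction k s w / (kl * taumin))).
  by field; rewrite ?mulf_neq0 ?gt_eqF.
rewrite -!mulrA mulrCA -mulrDr ler_pM2l// (le_trans le1)// lerD2l.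
by rewrite ler_wpM2l// invr_ge0 ltW.
Qed.

Lemma residual_le s w : (s < S)%N -> E w ->
  l2norm (g_at f p k s w + (J_at c p k s w)^T *m ytrue p k s w) ^+ 2 / kH ^+ 2
    + l2norm (c_at c p k s w) <= ((kl * taumin)^-1 + sigma^-1) * reduction k s
      w.
Proof.
move=> sS Ew; have [_ tt] := Ew k s k_ge sS.
apply: (kkt_residual_bound taumin_gt0 sigma01 kl_gt0 kH_gt0 _ _ tt).
- exact: det.
- exact: (hess_bounded ha k w sS).
- exact: reduction_ge.
Qed.

End Tail.

Lemma essbounded_on_event (Y : T -> R) K : measurable_fun setT Y ->
  (forall w, E w -> `|Y w| <= K) -> essbounded Q Y.
Proof.
move=> mY YK; split=> //; exists K.
by apply: filterS ae_merit_event => w; exact: YK.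
Qed.

Definition bounded_vec q (v : T -> 'cV[R]_q) :=
  random_mx v /\ exists K, forall w, E w -> l2norm (v w) <= K.

Lemma bounded_vecD q (u v : T -> 'cV[R]_q) :
  bounded_vec u -> bounded_vec v -> bounded_vec (fun w => u w + v w).
Proof.
move=> [mu [K uK]] [mv [M vM]]; split; first exact: random_mxD.
exists (K + M) => w Ew; rewrite (le_trans (l2normD _ _))// lerD//.
  exact: uK.
exact: vM.
Qed.

Lemma bounded_vecN q (v : T -> 'cV[R]_q) :
  bounded_vec v -> bounded_vec (fun w => - v w).
Proof.
move=> [mv [M vM]]; split; first exact: random_mxN.
by exists M => w Ew; rewrite l2normN; exact: vM.
Qed.

Lemma bounded_vecB q (u v : T -> 'cV[R]_q) :
  bounded_vec u -> bounded_vec v -> bounded_vec (fun w => u w - v w).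
Proof. by move=> bu bv; apply: bounded_vecD => //; exact: bounded_vecN. Qed.

Lemma bounded_vecZ q a (v : T -> 'cV[R]_q) :
  bounded_vec v -> bounded_vec (fun w => a *: v w).
Proof.
move=> [mv [M vM]]; split.
  by move=> i j; under eq_fun do rewrite mxE; exact: measurable_funM.
by exists (`|a| * M) => w Ew; rewrite l2normZ ler_wpM2l// vM.
Qed.

Lemma essbounded_dotv q (u v : T -> 'cV[R]_q) :
  bounded_vec u -> bounded_vec v -> essbounded Q (fun w => dotv (u w) (v w)).
Proof.
move=> [mu [K uK]] [mv [M vM]].
apply: (@essbounded_on_event _ (K * M)); first exact: random_dotv.
move=> w Ew; rewrite (le_trans (norm_dotv_le _ _))//.
by apply: ler_pM; rewrite ?l2norm_ge0 ?uK ?vM.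
Qed.

Lemma essbounded_coord q (v : T -> 'cV[R]_q) i :
  bounded_vec v -> essbounded Q (fun w => v w i 0).
Proof.
move=> [mv [M vM]]; apply: (@essbounded_on_event _ M) => // w Ew.
by rewrite (le_trans (coord_le_l2norm _ _))// vM.
Qed.

Lemma gbar_meas k s : (s < S)%N -> random_mx (gbar f b p k s).
Proof.
move=> sS i j; have [h _ _ _] := gbar_unbiased ge k sS i j.
exact: rintegrable_meas h.
Qed.

Lemma g_meas k s : (s < S)%N -> random_mx (g_at f p k s).
Proof.
move=> sS i j; have [_ _ h _] := gbar_unbiased ge k sS i j.
exact: rintegrable_meas h.
Qed.

Lemma constr_continuous i : continuous (constr c i).
Proof. by move=> x; apply: differentiable_continuous; have [] := c_C1 sp i. Qed.

(* [phi] is the identity in every application: it presents a sub-sigma-algebra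
   of [T] as a measurable type [U] on the same carrier. *)
Lemma random_c_at d' (U : measurableType d') (phi : U -> T) k s :
  random_mx (fun w => itr p k s (phi w)) ->
  random_mx (fun w => c_at c p k s (phi w)).
Proof.
move=> mi i j; rewrite ord1.
exact: (continuous_random_mx (@constr_continuous i) mi).
Qed.

Lemma random_J_at d' (U : measurableType d') (phi : U -> T) k s :
  random_mx (fun w => itr p k s (phi w)) ->
  random_mx (fun w => J_at c p k s (phi w)).
Proof.
move=> mi i j; under eq_fun do rewrite mxE.
exact: (continuous_random_mx (continuous_grad_coord (c_C1 sp i)) mi).
Qed.

Lemma c_at_l1norm_bound : exists K, forall k s w, (s <= S)%N ->
  l1norm (c_at c p k s w) <= K.
Proof.
pose K i := projT1 (cid (c_bounded sp i)).
exists (\sum_i K i) => k s w sS; apply: ler_sum => i _; rewrite /K.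
by case: cid => M /= /(_ _ (itrX k w sS)).
Qed.

Lemma c_at_bounded k s : (s <= S)%N -> bounded_vec (c_at c p k s).
Proof.
move=> sS; split; first exact: (random_c_at (phi := id) (itr_meas rp k sS)).
have [K cK] := c_at_l1norm_bound; exists K => w _.
by rewrite (le_trans (l2norm_le_l1norm _))// cK.
Qed.

Lemma essbounded_l1norm_c_at k s : (s <= S)%N ->
  essbounded Q (fun w => l1norm (c_at c p k s w)).
Proof.
move=> sS; have [K cK] := c_at_l1norm_bound.
apply: (@essbounded_on_event _ K) => [|w _]; last first.
  by rewrite ger0_norm ?l1norm_ge0// cK.
have [mc _] := c_at_bounded k sS.
by apply: measurable_sumT => i _; apply: measurableT_comp => //; exact: mc.
Qed.

Lemma g_at_bounded k s : (s < S)%N -> bounded_vec (g_at f p k s).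
Proof.
move=> sS; split; first exact: g_meas.
have [K gK] := gradf_bounded sp; exists K => w _.
exact/gK/itrX/ltnW.
Qed.

Lemma essbounded_merit k s : (s <= S)%N ->
  essbounded Q (fun w => merit f c (itr p k s w) taumin).
Proof.
move=> sS; apply: essboundedD; last exact: essbounded_l1norm_c_at.
apply: essboundedZ; have [K fK] := f_bounded sp.
apply: (@essbounded_on_event _ K) => [|w _]; last exact/fK/itrX.
apply: continuous_random_mx (itr_meas rp k sS) => x.
exact: differentiable_continuous.
Qed.

Section TailExpectation.
Variable k : nat.
Hypothesis k_ge : (kbar <= k)%N.

(** The model reduction is at least quadratic in |v| by hypothesis and at most affine in it, as [g]
    and the constraints are bounded. *)
Lemma direction_bounded s (g v : T -> 'cV[R]_n) : (s < S)%N ->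
  bounded_vec g -> random_mx v ->
  (forall w, E w -> kl * taumin * l2norm (v w) ^+ 2 <=
                    model_reduction (c_at c p k s w) taumin (g w) (v w)) ->
  bounded_vec v.
Proof.
move=> sS [_ [G gG]] mv le; split=> //; have [K cK] := c_at_l1norm_bound.
exists (1 + (taumin * `|G| + `|K|) / (kl * taumin)) => w Ew.
apply: quadratic_growth_bound; rewrite ?mulr_gt0 ?l2norm_ge0//.
  by rewrite mulr_ge0// ltW.
rewrite (le_trans (le w Ew))// /model_reduction; apply: lerD; last first.
  by rewrite (le_trans (cK _ _ _ (ltnW sS)))// ler_norm.
rewrite -mulrA mulNr -mulrN ler_wpM2l ?(ltW taumin_gt0)//.
have := norm_dotv_le (g w) (v w); rewrite ler_norml => /andP[h _].
rewrite lerNl (le_trans _ h)// lerN2 ler_wpM2r ?l2norm_ge0//.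
by rewrite (le_trans (gG w Ew))// ler_norm.
Qed.

Lemma gbar_bounded s : (s < S)%N -> bounded_vec (itr_dev k s) ->
  bounded_vec (gbar f b p k s).
Proof.
move=> sS [_ [K dK]]; split; first exact: gbar_meas.
have [G gG] := gradf_bounded sp; exists (L * K + G) => w Ew.
rewrite (le_trans (l2norm_svrg_le (f_lip sp) _ _ _ b_gt0 (run_batch run k w
  sS)))//.
by rewrite lerD ?ler_wpM2l ?dK// gG//; exact: itrX.
Qed.

Lemma dbar_bounded s : (s < S)%N -> bounded_vec (itr_dev k s) ->
  bounded_vec (dbar p k s).
Proof.
move=> sS bd; apply: (direction_bounded sS (gbar_bounded sS bd)).
  exact: (dbar_meas rp k sS).
by move=> w Ew; have [_] := mrb k sS Ew; rewrite merit_event_tau.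
Qed.

Lemma dtrue_bounded s : (s < S)%N -> bounded_vec (dtrue p k s).
Proof.
move=> sS; apply: (direction_bounded sS (g_at_bounded k sS)).
  exact: (dtrue_meas rp k sS).
by move=> w Ew; have [+ _] := mrb k sS Ew; rewrite merit_event_tau.
Qed.

(** [X] may be unbounded, so it is the displacement from the start of the epoch that is bounded: it
    starts at 0, and each step adds a direction that is bounded as long as the displacement is. *)
Lemma itr_dev_bounded s : (s <= S)%N -> bounded_vec (itr_dev k s).
Proof.
elim: s => [|s IH] sS.
  split; first by apply: random_mxB; exact: (itr_meas rp k (leq0n S)).
  by exists 0 => w _; rewrite /itr_dev subrr l2norm0.
have -> : itr_dev k s.+1 = (fun w => itr_dev k s w + alpha *: dbar p k s w).
  by apply/funext => w; rewrite /itr_dev itr_succ// addrAC.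
have bd := IH (ltnW sS).
by apply: bounded_vecD => //; apply: bounded_vecZ; exact: dbar_bounded.
Qed.

Section Step.
Variable s : nat.
Hypothesis sS : (s < S)%N.

Let bdev : bounded_vec (itr_dev k s). Proof. exact/itr_dev_bounded/ltnW. Qed.
Let bg := g_at_bounded k sS.
Let bgbar := gbar_bounded sS bdev.
Let bdbar := dbar_bounded sS bdev.
Let bd := dtrue_bounded sS.

Let berr : bounded_vec (g_err k s). Proof. exact: bounded_vecB. Qed.
Let bderr : bounded_vec (d_err k s). Proof. exact: bounded_vecB. Qed.

Lemma essbounded_reduction : essbounded Q (reduction k s).
Proof.
apply: essboundedD; last exact/essbounded_l1norm_c_at/ltnW.
by apply: essboundedZ; exact: essbounded_dotv.
Qed.

(** The generators are spelled out because the conditional expectation lemmas take a generating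
    family; [<<s Ggen >>] is [sigma_ks p k s] by conversion, and likewise for [Hgen] and [Fgen]. *)
Let Ggen : set (set T) := [set A | exists i j (B : set R),
  measurable B /\ A = (fun w => col_mx (itr p k 0%N w) (itr p k s w) i j) @^-1`
    B].
Let Hgen : set (set T) := [set A | exists i j (B : set R),
  measurable B /\ A = (fun w => hess p k s w i j) @^-1` B].
Let Fgen : set (set T) := [set A | exists i j (B : set R),
  measurable B /\ A = (fun w => gbar f b p k s w i j) @^-1` B].

Let G_meas : <<s Ggen >> `<=` measurable.
Proof.
apply: (sigma_mx_measurable (Y := fun w => col_mx (itr p k 0%N w) (itr p k s
  w))).
apply: random_col_mx; first exact: (itr_meas rp k (leq0n S)).
exact: (itr_meas rp k (ltnW sS)).
Qed.

Let H_meas : <<s Hgen >> `<=` measurable.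
Proof. exact: (sigma_mx_measurable (hess_meas rp k sS)). Qed.

Let F_meas : <<s Fgen >> `<=` measurable.
Proof. exact: (sigma_mx_measurable (gbar_meas k sS)). Qed.

Let JT := g_sigma_algebraType (join_gen Ggen Hgen).

Let join_meas (h : T -> R) : measurable_fun setT (h : JT -> R) ->
  measurable_fun setT h.
Proof.
move=> mh _ B mB; rewrite setTI; apply: (join_gen_meas G_meas H_meas).
by rewrite -[_ @^-1` _]setTI; exact: mh.
Qed.

Let err_orthogonal_coord (h : T -> R) j : measurable_fun setT (h : JT -> R) ->
  essbounded Q h -> mean Q (fun w => h w * g_err k s w j 0) = 0.
Proof.
move=> mh bh; have -> : (fun w => h w * g_err k s w j 0) =
   (fun w => h w * (gbar f b p k s w j 0 - g_at f p k s w j 0)).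
  by apply/funext => w; rewrite !mxE.
have e1 B : measurable B -> <<s Fgen >> ((fun w => gbar f b p k s w j 0) @^-1`
  B).
  by move=> mB; exact: (sigma_mx_entry (Y := gbar f b p k s) j 0 mB).
exact: (cond_independent_orthogonal G_meas H_meas F_meas (hess_indep ge sS)
  e1 (essbounded_coord j bgbar) (gbar_unbiased ge k sS j 0) mh bh).
Qed.

Let random_join q r (Y : T -> 'M[R]_(q, r)) : Prop :=
  @random_mx _ JT R q r Y.

Let join_itr0 : random_join (itr p k 0%N).
Proof.
move=> i j; apply/sigma_measurableP => B mB; apply: sub_join_r.
have -> : (fun w => itr p k 0%N w i j) =
    (fun w => col_mx (itr p k 0%N w) (itr p k s w) (lshift n i) j).
  by apply/funext => w; rewrite col_mxEu.
exact: (sigma_mx_entry (Y := fun w => col_mx (itr p k 0%N w) (itr p k s w))).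
Qed.

Let join_itr : random_join (itr p k s).
Proof.
move=> i j; apply/sigma_measurableP => B mB; apply: sub_join_r.
have -> : (fun w => itr p k s w i j) =
    (fun w => col_mx (itr p k 0%N w) (itr p k s w) (rshift n i) j).
  by apply/funext => w; rewrite col_mxEd.
exact: (sigma_mx_entry (Y := fun w => col_mx (itr p k 0%N w) (itr p k s w))).
Qed.

Let join_dev : random_join (itr_dev k s).
Proof. exact: random_mxB join_itr join_itr0. Qed.

Let join_g : random_join (g_at f p k s).
Proof.
move=> i j; apply/sigma_measurableP => B mB; apply: sub_join_r.
by have [_ h _ _] := gbar_unbiased ge k sS i j; exact: h.
Qed.

Let join_K : random_join (fun w => invmx (K_at c p k s w)).
Proof.
apply: random_invmx => [|w]; last exact: K_unit.
apply: random_kkt_mx; last exact: (random_J_at (phi := id : JT -> T) join_itr).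
move=> i j; apply/sigma_measurableP => B mB; apply: sub_join_l.
exact: (sigma_mx_entry (Y := hess p k s)).
Qed.

Let join_usubmx q r (Y : T -> 'cV[R]_(q + r)) : random_join Y ->
  random_join (fun w => usubmx (Y w)).
Proof. by move=> mY i j; under eq_fun do rewrite mxE; exact: mY. Qed.

(** The true direction is a function of Hessian and iterates through the inverse KKT matrix, which
    makes it an admissible multiplier of [g_err]. *)
Let join_dtrue : random_join (dtrue p k s).
Proof.
have -> : dtrue p k s = (fun w => usubmx (invmx (K_at c p k s w) *m
    - col_mx (g_at f p k s w) (c_at c p k s w))).
  by apply/funext => w; rewrite -det// mulKmx ?K_unit// col_mxKu.
apply: join_usubmx; apply: random_mxM join_K _; apply: random_mxN.
by apply: random_col_mx => //; exact: (random_c_at (phi := id : JT -> T)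
  join_itr).
Qed.

(* Primal component of the KKT solution with right-hand side the j-th basis
   vector: [d_err] is minus the combination of these with weights [g_err]. *)
Let kkt_col j w : 'cV[R]_n :=
  usubmx (invmx (K_at c p k s w) *m col_mx (delta_mx j 0) 0).

Let d_errE w : d_err k s w = - \sum_j g_err k s w j 0 *: kkt_col j w.
Proof.
have : col_mx (d_err k s w) (y_err k s w) =
    invmx (K_at c p k s w) *m col_mx (- g_err k s w) 0.
  by rewrite -K_err// mulKmx// K_unit.
move=> /(congr1 usubmx); rewrite col_mxKu => ->; move: (g_err k s w) => e.
have -> : col_mx (- e) (0 : 'cV[R]_m) =
    - \sum_j e j 0 *: col_mx (delta_mx j 0) 0.
  rewrite -[0 in LHS]oppr0 -opp_col_mx; congr (- _).
  apply/colP => i; rewrite summxE; case: (split_ordP i) => a ->.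
    rewrite col_mxEu (bigD1 a)//= big1 => [|j ja].
      by rewrite mxE col_mxEu mxE !eqxx mulr1 addr0.
    by rewrite mxE col_mxEu mxE eq_sym (negbTE ja) mulr0.
  by rewrite col_mxEd mxE big1// => j _; rewrite mxE col_mxEd mxE mulr0.
rewrite mulmxN mulmx_sumr linearN linear_sum; congr (- _).
by apply: eq_bigr => j _; rewrite -scalemxAr linearZ.
Qed.

Let join_kkt_col j : random_join (kkt_col j).
Proof.
by apply: join_usubmx; apply: random_mxM join_K _; exact: random_mx_cst.
Qed.

Let kkt_col_bounded j : bounded_vec (kkt_col j).
Proof.
split=> [i j'|]; first by apply: join_meas; exact: join_kkt_col.
exists (l2norm (delta_mx j 0 : 'cV[R]_n) / zeta) => w Ew.
pose y : 'cV[R]_(n + m) := invmx (K_at c p k s w) *m col_mx (delta_mx j 0) 0.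
have Ky : K_at c p k s w *m col_mx (kkt_col j w) (dsubmx y) = col_mx (delta_mx j
  0) 0.
  by rewrite vsubmxK mulKVmx// K_unit.
exact: (kkt_bound zeta_gt0 (fun u => hess_curv ha sS) Ky).
Qed.

Lemma mean_dot_g_err (v : T -> 'cV[R]_n) : random_join v -> bounded_vec v ->
  mean Q (fun w => dotv (g_err k s w) (v w)) = 0.
Proof.
move=> jv bv; rewrite mean_sum => [|j _]; last first.
  by apply/essbounded_integrable/essboundedM; exact: essbounded_coord.
apply: big1 => j _.
under [X in mean Q X]eq_fun do rewrite mulrC.
by apply: err_orthogonal_coord => //; exact: essbounded_coord.
Qed.

(** By [d_errE] the product is a combination of the coordinates of [g_err] whose coefficients are
    bounded and depend on Hessian and iterates only, so orthogonality applies coordinate by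
    coordinate. *)
Lemma mean_dot_d_err (v : T -> 'cV[R]_n) : random_join v -> bounded_vec v ->
  mean Q (fun w => dotv (v w) (d_err k s w)) = 0.
Proof.
move=> jv bv.
have -> : (fun w => dotv (v w) (d_err k s w)) =
    (fun w => \sum_j (- dotv (v w) (kkt_col j w)) * g_err k s w j 0).
  apply/funext => w; rewrite d_errE dotvNr.
  have -> (I : Type) (r : seq I) (F : I -> 'cV[R]_n) :
      dotv (v w) (\sum_(i <- r) F i) = \sum_(i <- r) dotv (v w) (F i).
    by elim/big_rec2: _ => [|i x y _ <-]; rewrite ?dotv0r// dotvDr.
  by rewrite -sumrN; apply: eq_bigr => j _; rewrite dotvZr mulrC mulNr.
have bh j : essbounded Q (fun w => - dotv (v w) (kkt_col j w)).
  by apply/essboundedN/essbounded_dotv.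
rewrite mean_sum => [|j _]; last first.
  by apply/essbounded_integrable/essboundedM => //; exact: essbounded_coord.
apply: big1 => j _; apply: err_orthogonal_coord => //.
apply: measurable_funN; exact: random_dotv jv (join_kkt_col j).
Qed.

Let dev2 w := dotv (itr_dev k s w) (itr_dev k s w).
Let dbar2 w := dotv (dbar p k s w) (dbar p k s w).

Let idev2 : rintegrable Q dev2.
Proof. exact/essbounded_integrable/essbounded_dotv. Qed.

Let idbar2 : rintegrable Q dbar2.
Proof. exact/essbounded_integrable/essbounded_dotv. Qed.

Let ired : rintegrable Q (reduction k s).
Proof. exact/essbounded_integrable/essbounded_reduction. Qed.

Lemma mean_g_err_sqr : mean Q (fun w => l2norm (g_err k s w) ^+ 2) <=
  L ^+ 2 / b%:R * mean Q dev2.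
Proof.
have [V [cV Vle]] := gbar_variance ge k sS.
rewrite -(condexp_meanT cV) -meanZ//; have [_ _ iV _] := cV.
apply: mean_le => //; first exact: rintegrableZ.
by apply: filterS Vle => w; rewrite sqr_l2norm; apply.
Qed.

Lemma mean_dbar_sqr : mean Q dbar2 <=
  mean Q (reduction k s) / (kl * taumin)
    + L ^+ 2 / (kl * b%:R * zeta) * mean Q dev2.
Proof.
have kt : 0 < kl * taumin by rewrite mulr_gt0.
have ie2 : rintegrable Q (fun w => l2norm (g_err k s w) ^+ 2).
  under eq_fun do rewrite sqr_l2norm.
  exact/essbounded_integrable/essbounded_dotv.
have ied : rintegrable Q (fun w => dotv (g_err k s w) (dtrue p k s w)).
  exact/essbounded_integrable/essbounded_dotv.
have igu : rintegrable Q (fun w => dotv (g_at f p k s w) (d_err k s w)).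
  exact/essbounded_integrable/essbounded_dotv.
pose i3 := rintegrableD ired (rintegrableZ (taumin / zeta) ie2).
pose i4 := rintegrableB i3 (rintegrableZ taumin ied).
pose i5 := rintegrableB i4 (rintegrableZ taumin igu).
have : mean Q (fun w => kl * taumin * dbar2 w) <= mean Q (fun w =>
    reduction k s w + taumin / zeta * l2norm (g_err k s w) ^+ 2
      - taumin * dotv (g_err k s w) (dtrue p k s w)
      - taumin * dotv (g_at f p k s w) (d_err k s w)).
  apply: mean_le => //; first exact: rintegrableZ.
  by apply: filterS ae_merit_event => w; exact: reduction_dbar.
rewrite (meanB i4 (rintegrableZ taumin igu)) (meanB i3 (rintegrableZ taumin
  ied)).
rewrite (meanD ired (rintegrableZ _ ie2)) !meanZ//.
rewrite mean_dot_g_err// mean_dot_d_err// !mulr0 !subr0 => le.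
have le2 := ler_wpM2l (ltW (divr_gt0 taumin_gt0 zeta_gt0)) mean_g_err_sqr.
have -> : L ^+ 2 / (kl * b%:R * zeta) * mean Q dev2 =
  taumin / zeta * (L ^+ 2 / b%:R * mean Q dev2) / (kl * taumin).
  by field; rewrite ?mulf_neq0 ?gt_eqF ?ltr0n.
rewrite -mulrDl ler_pdivlMr// mulrC (le_trans le)// lerD2l//.
Qed.

Lemma mean_merit_succ :
  mean Q (fun w => merit f c (itr p k s.+1 w) taumin) <=
  mean Q (fun w => merit f c (itr p k s w) taumin)
    - alpha * mean Q (reduction k s)
    + alpha ^+ 2 * (taumin * L + Gam) / 2 * mean Q dbar2.
Proof.
have i0 : rintegrable Q (fun w => merit f c (itr p k s w) taumin).
  exact/essbounded_integrable/essbounded_merit/ltnW.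
have i1 := rintegrableB i0 (rintegrableZ alpha ired).
have igu : rintegrable Q (fun w => - dotv (g_at f p k s w) (d_err k s w)).
  exact/essbounded_integrable/essboundedN/essbounded_dotv.
have i2 := rintegrableB i1 (rintegrableZ (alpha * taumin) igu).
have i3 := rintegrableZ (alpha ^+ 2 * (taumin * L + Gam) / 2) idbar2.
have z : mean Q (fun w => - dotv (g_at f p k s w) (d_err k s w)) = 0.
  under [X in mean Q X]eq_fun do rewrite -mulN1r.
  rewrite meanZ ?mean_dot_d_err ?mulr0//.
  exact/essbounded_integrable/essbounded_dotv.
have le : mean Q (fun w => merit f c (itr p k s.+1 w) taumin) <= mean Q (fun w
  =>
    merit f c (itr p k s w) taumin - alpha * reduction k s w
    - alpha * taumin * - dotv (g_at f p k s w) (d_err k s w)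
    + alpha ^+ 2 * (taumin * L + Gam) / 2 * dbar2 w).
  apply: mean_le; first exact/essbounded_integrable/essbounded_merit.
    exact: rintegrableD.
  by apply: aeW => w; exact: merit_itr_succ.
apply: (le_trans le).
rewrite (meanD i2 i3) (meanB i1 (rintegrableZ _ igu)) (meanB i0 (rintegrableZ _
  ired)).
by rewrite !meanZ// z mulr0 subr0.
Qed.

Lemma mean_dev_succ z : 0 < z ->
  mean Q (fun w => dotv (itr_dev k s.+1 w) (itr_dev k s.+1 w)) <=
  (1 + alpha * z) * mean Q dev2
    + alpha / (z * (kl * taumin)) * mean Q (reduction k s)
    + alpha ^+ 2 * mean Q dbar2.
Proof.
move=> z0.
have i1 := rintegrableZ (1 + alpha * z) idev2.
have i2 := rintegrableZ (alpha / (z * (kl * taumin))) ired.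
have ivu : rintegrable Q (fun w => dotv (itr_dev k s w) (d_err k s w)).
  exact/essbounded_integrable/essbounded_dotv.
have i3 := rintegrableZ (2 * alpha) ivu.
have i4 := rintegrableZ (alpha ^+ 2) idbar2.
have i12 := rintegrableD i1 i2; have i123 := rintegrableD i12 i3.
have le : mean Q (fun w => dotv (itr_dev k s.+1 w) (itr_dev k s.+1 w)) <=
  mean Q (fun w => (1 + alpha * z) * dev2 w
    + alpha / (z * (kl * taumin)) * reduction k s w
    + 2 * alpha * dotv (itr_dev k s w) (d_err k s w) + alpha ^+ 2 * dbar2 w).
  apply: mean_le.
  - by apply/essbounded_integrable/essbounded_dotv; exact: itr_dev_bounded.
  - exact: rintegrableD.
  - by apply: filterS ae_merit_event => w; exact: itr_dev_succ.
apply: (le_trans le).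
rewrite (meanD i123 i4) (meanD i12 i3) (meanD i1 i2) !meanZ//.
by rewrite mean_dot_d_err// mulr0 addr0.
Qed.

End Step.

End TailExpectation.

(** * Decrease of the potential and telescoping *)

Section Lyapunov.
Variables (z : R) (lam Lam : nat -> R).
Hypothesis z_gt0 : 0 < z.
Hypothesis A_ge0 : 0 <= taumin * L + Gam.
Hypothesis lam_ge0 : forall s, (s <= S)%N -> 0 <= lam s.
Hypothesis lamS : lam S = 0.
Hypothesis lamE : forall s, (s < S)%N -> lam s =
  lam s.+1 * (alpha ^+ 2 * L ^+ 2 / (kl * b%:R * zeta) + alpha * z + 1)
  + alpha ^+ 2 * (taumin * L + Gam) * L ^+ 2 / (2 * kl * b%:R * zeta).
Hypothesis LamE : forall s, (s < S)%N -> Lam s =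
  alpha - alpha ^+ 2 * (taumin * L + Gam) / (2 * taumin * kl)
  - lam s.+1 * (alpha / (taumin * kl)) * (alpha + z^-1).

Let phi k s := mean Q (fun w => merit f c (itr p k s w) taumin).
Let dev k s := mean Q (fun w => dotv (itr_dev k s w) (itr_dev k s w)).

Lemma lyapunov_decrease k s : (kbar <= k)%N -> (s < S)%N ->
  phi k s.+1 + lam s.+1 * dev k s.+1 <=
    phi k s + lam s * dev k s - Lam s * mean Q (reduction k s).
Proof.
move=> kk sS; have kt : 0 < kl * taumin by rewrite mulr_gt0.
have l0 := lam_ge0 sS.
have h1 := mean_merit_succ kk sS; have h2 := mean_dev_succ kk sS z_gt0.
have h3 := mean_dbar_sqr kk sS; rewrite -/(phi k s.+1) -/(phi k s) in h1.
rewrite -/(dev k s.+1) -/(dev k s) in h2 h3; rewrite LamE// (lamE sS).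
move: h1 h2 h3; set D := mean Q (reduction k s); set B := mean Q _.
set A := taumin * L + Gam; set E0 := dev k s => h1 h2 h3.
have co0 : 0 <= alpha ^+ 2 * A / 2 + lam s.+1 * alpha ^+ 2.
  apply: addr_ge0; last by apply: mulr_ge0 => //; exact: sqr_ge0.
  by rewrite -mulrA; apply: mulr_ge0; [exact: sqr_ge0|exact: divr_ge0].
(* The multiplier of [h3] is the total coefficient of the mean of |dbar|^2 in [h1] and [lam s.+1]
   times [h2], so this mean cancels. What remains is an identity: the formulas for [lam] and [Lam]
   collect the coefficients of the deviation and of the reduction. *)
have h4 := lerD (lerD h1 (ler_wpM2l l0 h2)) (ler_wpM2l co0 h3).
rewrite -(lerD2r ((alpha ^+ 2 * A / 2 + lam s.+1 * alpha ^+ 2) * B)).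
apply: (le_trans h4); rewrite le_eqVlt; apply/orP; left; apply/eqP.
by field; rewrite ?mulf_neq0 ?gt_eqF ?ltr0n.
Qed.

(** The reference point of the deviation is reset at each outer iteration, so the potential is a
    plain merit value at the start of the epoch, and at its end because [lam S = 0]. *)
Lemma epoch_decrease k : (kbar <= k)%N ->
  \sum_(s < S) Lam s * mean Q (reduction k s) <= phi k 0 - phi k.+1 0.
Proof.
move=> kk.
have dev0 : dev k 0 = 0.
  rewrite /dev -(mean_cst Q 0); congr mean; apply/funext => w.
  by rewrite /itr_dev subrr dotv0r.
have phiS : phi k.+1 0 = phi k S.
  by congr mean; apply/funext => w; rewrite (run_outer run).
suff key r : (r <= S)%N -> \sum_(s < r) Lam s * mean Q (reduction k s) <=
    phi k 0 - (phi k r + lam r * dev k r).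
  by have := key S (leqnn S); rewrite lamS mul0r addr0 phiS.
elim: r => [|r IH] rS; first by rewrite big_ord0 dev0 mulr0 addr0 subrr.
rewrite big_ord_recr /=.
by have := IH (ltnW rS); have := lyapunov_decrease kk rS; lra.
Qed.

Lemma reduction_mean_ge0 k s : (kbar <= k)%N -> (s < S)%N ->
  0 <= mean Q (reduction k s).
Proof.
move=> kk sS; rewrite -(mean_cst Q 0); apply: mean_le.
- exact: rintegrable_cst.
- exact/essbounded_integrable/essbounded_reduction.
- apply: filterS ae_merit_event => w Ew; apply: le_trans (reduction_ge kk sS
  Ew).
  by apply: mulr_ge0 (sqr_ge0 _); rewrite ltW// mulr_gt0.
Qed.

Lemma tail_decrease (r : R) k : (kbar <= k)%N -> (forall s, (s < S)%N -> r <=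
  Lam s) ->
  r * (\sum_(kbar <= j < k.+1) \sum_(s < S) mean Q (reduction j s)) <=
    phi kbar 0 - phi k.+1 0.
Proof.
move=> kk rLam; rewrite -opprB -(telescope_sumr (fun j => phi j 0)) ?leqW//.
rewrite -sumrN mulr_sumr !big_seq; apply: ler_sum => j.
rewrite mem_index_iota => /andP[kj _]; rewrite opprB.
apply: le_trans (epoch_decrease kj); rewrite mulr_sumr; apply: ler_sum => s _.
by rewrite ler_wpM2r ?rLam ?reduction_mean_ge0.
Qed.

End Lyapunov.

Definition residual k w : R :=
  \sum_(kbar <= j < k.+1) \sum_(s < S)
    (l2norm (g_at f p j s w + (J_at c p j s w)^T *m ytrue p j s w) ^+ 2 / kH ^+
      2
     + l2norm (c_at c p j s w)).

Lemma mean_residual_le k : (kbar <= k)%N ->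
  rintegrable Q (residual k) /\
  mean Q (residual k) <= ((kl * taumin)^-1 + sigma^-1) *
    \sum_(kbar <= j < k.+1) \sum_(s < S) mean Q (reduction j s).
Proof.
move=> kk; pose C := (kl * taumin)^-1 + sigma^-1.
pose t j s w : R := l2norm (g_at f p j s w + (J_at c p j s w)^T *m ytrue p j s
  w) ^+ 2
  / kH ^+ 2 + l2norm (c_at c p j s w).
have t0 j s w : 0 <= t j s w.
  by rewrite addr_ge0 ?l2norm_ge0// divr_ge0 ?sqr_ge0.
have ired j s : (kbar <= j)%N -> (s < S)%N -> rintegrable Q (reduction j s).
  by move=> kj sS; exact/essbounded_integrable/essbounded_reduction.
have mt j s : (s < S)%N -> measurable_fun setT (t j s).
  move=> sS; have [mc _] := c_at_bounded j (ltnW sS).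
  apply: measurable_funD; last exact: random_l2norm.
  apply: measurable_funM => //; apply: measurable_funX; apply: random_l2norm.
  apply: random_mxD; first exact: g_meas.
  apply: random_mxM; last exact: (ytrue_meas rp j sS).
  move=> i i'; under eq_fun do rewrite mxE.
  exact: (random_J_at (phi := id) (itr_meas rp j (ltnW sS))).
have tle j s : (kbar <= j)%N -> (s < S)%N ->
    {ae Q, forall w, t j s w <= C * reduction j s w}.
  by move=> kj sS; apply: filterS ae_merit_event => w; exact: residual_le.
have it j s : (kbar <= j)%N -> (s < S)%N -> rintegrable Q (t j s).
  move=> kj sS; have iC := rintegrableZ C (ired _ _ kj sS).
  (* The bound on [t] holds almost surely only; cutting [t] off at the bound gives a function
     dominated everywhere and almost surely equal to [t]. *)
  pose t' w := Num.min (t j s w) `|C * reduction j s w|.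
  have mt' : measurable_fun setT t'.
    apply: measurable_minr; first exact: mt.
    exact: rintegrable_meas (rintegrable_norm iC).
  apply: (@rintegrable_ae _ _ _ Q t'); first exact: mt.
    apply: rintegrable_le (rintegrable_norm iC) _ => // w.
    by rewrite ger0_norm ?le_min ?t0 ?normr_ge0// ge_min lexx orbT.
  apply: filterS (tle _ _ kj sS) => w le; rewrite /t' min_l//.
  by rewrite (le_trans le)// ler_norm.
(* The lower end of the range is repeated as a predicate so that the summation lemmas supply it as a
   hypothesis. *)
have resE : residual k = (fun w => \sum_(j <- index_iota kbar k.+1 | (kbar <=
  j)%N)
    \sum_(s < S) t j s w).
  apply/funext => w; rewrite /residual big_seq_cond [RHS]big_seq_cond.
  by apply: eq_bigl => j; rewrite mem_index_iota; case: (kbar <= j)%N; rewrite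
    ?andbT ?andbF.
have iin j : (kbar <= j)%N -> rintegrable Q (fun w => \sum_(s < S) t j s w).
  by move=> kj; apply: rintegrable_sum => s _; exact: it.
rewrite resE; split; first exact: rintegrable_sum.
rewrite mean_sum// mulr_sumr [leRHS]big_seq_cond [leLHS]big_mkcond /=
  [leLHS]big_seq_cond.
apply: ler_sum => j; rewrite andbT mem_index_iota => /andP[kj _]; rewrite kj.
rewrite mean_sum => [|s _]; last exact: it.
rewrite mulr_sumr; apply: ler_sum => s _; rewrite -meanZ ?ired//.
by apply: mean_le; [exact: it|exact/rintegrableZ/ired|exact: tle].
Qed.

(** * Conditional errors near a stationary point *)

Section LocalError.
Variables (k s : nat).
Hypothesis sS : (s < S)%N.

Let Ggen : set (set T) := [set A | exists i j (B : set R),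
  measurable B /\ A = (fun w => col_mx (itr p k 0%N w) (itr p k s w) i j) @^-1`
    B].

Let G_meas : <<s Ggen >> `<=` measurable.
Proof.
apply: (sigma_mx_measurable (Y := fun w => col_mx (itr p k 0%N w) (itr p k s
  w))).
apply: random_col_mx; first exact: (itr_meas rp k (leq0n S)).
exact: (itr_meas rp k (ltnW sS)).
Qed.

Let merr : random_mx (g_err k s).
Proof. by apply: random_mxB; [exact: gbar_meas|exact: g_meas]. Qed.

(* Conditional Jensen in quantitative form: [W <= (W^2 / r + r) / 2] for all
   [r > 0], applied with [r] decreasing to [beta]. *)
Lemma condexp_le_of_variance (D : set T) (Y h : T -> R) (a beta eta : R) :
  0 <= a -> 0 <= beta -> rintegrable Q Y ->
  (forall B, measurable B -> <<s Ggen >> (h @^-1` B)) -> rintegrable Q h ->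
  {ae Q, forall w, Y w <= a * l2norm (g_err k s w) + h w} ->
  (forall w, D w -> L ^+ 2 / b%:R * l2norm (itr_dev k s w) ^+ 2 <= beta ^+ 2) ->
  (forall w, D w -> h w <= eta) ->
  condexp_le_on Q (sigma_ks p k s) D Y (fun=> a * beta + eta).
Proof.
move=> a0 beta0 iY mh ih Yle Dbeta Deta.
have [V2 [cV2 V2le]] := gbar_variance ge k sS.
have [V cV] := condexp_exists G_meas iY; exists V; split=> //.
(* A countable family of radii, positive even if [beta] is 0: the exceptional null sets can be
   united before the limit is taken. *)
pose r i : R := beta + i.+1%:R^-1.
have r0 i : 0 < r i by rewrite ltr_wpDl.
have Vle i : {ae Q, forall w,
    V w <= a / (2 * r i) * V2 w + (h w + a * r i / 2)}.
  have ih' : rintegrable Q (fun w => h w + a * r i / 2).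
    by apply: rintegrableD => //; exact: rintegrable_cst.
  have mh' B : measurable B -> <<s Ggen >> ((fun w => h w + a * r i / 2) @^-1`
    B).
    apply: (sigma_measurableP Ggen _).2; apply: measurable_funD => //.
    exact: (sigma_measurableP Ggen h).1.
  have cA := condexp_affine G_meas (a / (2 * r i)) cV2 mh' ih'.
  apply: (condexp_le G_meas cV cA); apply: filterS Yle => w /le_trans; apply.
  rewrite addrCA [leLHS]addrC lerD2l -/(g_err k s w); set W := l2norm _.
  rewrite -subr_ge0 (_ : _ - _ = a / (2 * r i) * (W - r i) ^+ 2).
    by rewrite mulr_ge0 ?sqr_ge0// divr_ge0// mulr_ge0// ltW.
  by field; rewrite gt_eqF.
apply: filterS2 V2le (ae_foralln Vle) => w V2w Vw Dw.
apply/ler_addgt0Pl => e e0.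
have {}V2w : V2 w <= beta ^+ 2 by rewrite (le_trans (V2w I))// Dbeta.
have le i : V w <= a * beta + eta + a * i.+1%:R^-1.
  apply: (le_trans (Vw i)).
  have le1 : a / (2 * r i) * V2 w <= a * r i / 2.
    have -> : a * r i / 2 = a / (2 * r i) * r i ^+ 2.
      by field; rewrite gt_eqF.
    rewrite ler_wpM2l//; first by rewrite divr_ge0// mulr_ge0// ltW.
    rewrite (le_trans V2w)// lerXn2r ?nnegrE// ?(ltW (r0 i))//.
    by rewrite lerDl.
  have -> : a * beta + eta + a * i.+1%:R^-1 = a * r i / 2 + (eta + a * r i / 2).
    by rewrite /r; field.
  by rewrite lerD// lerD2r Deta.
pose i := Num.truncn (a / e).
apply: (le_trans (le i)); rewrite addrC lerD2r ler_pdivrMr//.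
by rewrite mulrC -ler_pdivrMr// ltW// truncnS_gt.
Qed.

Let iW : rintegrable Q (fun w => l2norm (g_err k s w)).
Proof.
have [V2 [[iW2 _ _ _] _]] := gbar_variance ge k sS.
apply: (rintegrable_le (Y := fun w => l2norm (g_err k s w) ^+ 2 + 1)).
- exact: random_l2norm.
- by apply: rintegrableD => //; exact: rintegrable_cst.
- move=> w; rewrite ger0_norm ?l2norm_ge0//; set x := l2norm _.
  have := sqr_ge0 (x - 1); have := sqr_ge0 x; nra.
Qed.

Lemma essbounded_l2norm q (v : T -> 'cV[R]_q) : bounded_vec v ->
  essbounded Q (fun w => l2norm (v w)).
Proof.
move=> [mv [K vK]]; apply: (@essbounded_on_event _ K) => [|w Ew].
  exact: random_l2norm.
by rewrite ger0_norm ?l2norm_ge0// vK.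
Qed.

Let G_g : @random_mx _ (g_sigma_algebraType Ggen) R n 1 (g_at f p k s).
Proof.
move=> i j; apply/sigma_measurableP => B mB.
by have [_ h _ _] := gbar_unbiased ge k sS i j; exact: h.
Qed.

Let G_itr : @random_mx _ (g_sigma_algebraType Ggen) R n 1 (itr p k s).
Proof.
move=> i j; apply/sigma_measurableP => B mB.
have -> : (fun w => itr p k s w i j) =
    (fun w => col_mx (itr p k 0%N w) (itr p k s w) (rshift n i) j).
  by apply/funext => w; rewrite col_mxEd.
exact: (sigma_mx_entry (Y := fun w => col_mx (itr p k 0%N w) (itr p k s w))).
Qed.

Variables (xs : 'cV[R]_n) (dx dx0 dc : R).
Hypotheses (dx_gt0 : 0 < dx) (dx0_gt0 : 0 < dx0).
Let D := [set w : T | [/\ l2norm (itr p k s w - xs) <= dx,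
  l2norm (itr p k 0%N w - xs) <= dx0 & l2norm (c_at c p k s w) <= dc]].
(** Square root of the variance bound on [D], where the triangle inequality through [xs] bounds the
    deviation by dx0 + dx. *)
Let beta := L * (dx0 + dx) / Num.sqrt b%:R.

Let beta_ge0 : 0 <= beta.
Proof. by rewrite divr_ge0 ?sqrtr_ge0// mulr_ge0// ltW// addr_gt0. Qed.

Let dev_le_beta w : D w -> L ^+ 2 / b%:R * l2norm (itr_dev k s w) ^+ 2 <= beta
  ^+ 2.
Proof.
move=> [h1 h2 _].
have -> : beta ^+ 2 = L ^+ 2 / b%:R * (dx0 + dx) ^+ 2.
  by rewrite /beta exprMn exprVn sqr_sqrtr ?ler0n// exprMn mulrAC.
rewrite ler_wpM2l ?divr_ge0 ?sqr_ge0 ?ler0n//.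
rewrite lerXn2r ?nnegrE ?l2norm_ge0 ?(ltW (addr_gt0 dx0_gt0 dx_gt0))//.
have -> : itr_dev k s w = (itr p k s w - xs) - (itr p k 0%N w - xs).
  by rewrite opprB addrA subrK.
by rewrite (le_trans (l2normD _ _))// l2normN addrC lerD.
Qed.

(** The gradient gap splits into [g_err], handled through its variance, and
    [g_at - grad (favg f) xs], which depends on the iterate alone and is at most L dx on [D]. *)
Lemma condexp_rhs_error_le :
  condexp_le_on Q (sigma_ks p k s) D
    (fun w => l2norm (col_mx (gbar f b p k s w - grad (favg f) xs) (c_at c p k s
      w)))
    (fun=> dc + beta + L * dx).
Proof.
pose h w := l2norm (g_at f p k s w - grad (favg f) xs) + l2norm (c_at c p k s
  w).
have bg : bounded_vec (fun w => g_at f p k s w - grad (favg f) xs).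
  apply: bounded_vecB; first exact: g_at_bounded.
  by split; [exact: random_mx_cst|exists (l2norm (grad (favg f) xs))].
have bc := c_at_bounded k (ltnW sS).
have ih : rintegrable Q h.
  by apply/essbounded_integrable/essboundedD; exact: essbounded_l2norm.
have le w : l2norm (col_mx (gbar f b p k s w - grad (favg f) xs) (c_at c p k s
  w)) <=
    1 * l2norm (g_err k s w) + h w.
  rewrite (le_trans (l2norm_col_mx_le _ _))// mul1r /h addrA lerD2r.
  by rewrite (le_trans _ (l2normD _ _))// /g_err addrA subrK.
have -> : (fun=> dc + beta + L * dx) = (fun=> 1 * beta + (L * dx + dc)) :> (T ->
  R).
  by apply/funext => _; ring.
apply: (condexp_le_of_variance (h := h)) => //.
- apply: rintegrable_le (rintegrableD (rintegrableZ 1 iW) ih) _ => [|w].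
    apply: random_l2norm; apply: random_col_mx; last by case: bc.
    by apply: random_mxB; [exact: gbar_meas|exact: random_mx_cst].
  by rewrite ger0_norm ?l2norm_ge0.
- apply: (sigma_measurableP Ggen h).2; apply: measurable_funD.
    by apply: random_l2norm; apply: random_mxB => //; exact: random_mx_cst.
  by apply: random_l2norm; exact: (random_c_at (phi := id : g_sigma_algebraType
    Ggen -> T) G_itr).
- exact: aeW.
- move=> w [h1 _ h3]; rewrite /h lerD//.
  by rewrite (le_trans (favg_lip _ _))// ler_wpM2l.
Qed.

Lemma y_err_le kd w : opnorm2 (invmx (K_at c p k s w)) <= kd ->
  l2norm (y_err k s w) <= kd * l2norm (g_err k s w).
Proof.
move=> le; have E1 : col_mx (d_err k s w) (y_err k s w) =
    invmx (K_at c p k s w) *m col_mx (- g_err k s w) 0.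
  by rewrite -K_err// mulKmx// K_unit.
apply: (@le_trans _ _ (l2norm (col_mx (d_err k s w) (y_err k s w)))).
  rewrite -(@ler_pXn2r _ 2)// ?nnegrE ?l2norm_ge0//.
  by rewrite sqr_l2norm_col_mx lerDr sqr_ge0.
rewrite E1 (le_trans (opnorm2P _ _))//.
have -> : l2norm (col_mx (- g_err k s w) (0 : 'cV[R]_m)) = l2norm (g_err k s w).
  apply/eqP; rewrite -(@eqrXn2 _ 2)// ?l2norm_ge0// sqr_l2norm_col_mx.
  by rewrite l2normN l2norm0 expr0n addr0.
by rewrite ler_wpM2r// l2norm_ge0.
Qed.

(** The multiplier error is a block of the solution in [K_err], so it is at most [kd] times |g_err|,
    whose conditional mean is bounded by [beta]. *)
Lemma condexp_multiplier_error_le kd : 0 < kd ->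
  (forall w, E w -> opnorm2 (invmx (K_at c p k s w)) <= kd) ->
  condexp_le_on Q (sigma_ks p k s) D
    (fun w => l2norm (ybar p k s w - ytrue p k s w)) (fun=> kd * beta).
Proof.
move=> kd0 Kle.
have le : {ae Q, forall w, l2norm (y_err k s w) <= kd * l2norm (g_err k s w)}.
  by apply: filterS ae_merit_event => w Ew; apply: y_err_le; exact: Kle.
have my : measurable_fun setT (fun w => l2norm (y_err k s w)).
  apply: random_l2norm; apply: random_mxB.
    exact: (ybar_meas rp k sS).
  exact: (ytrue_meas rp k sS).
have iY : rintegrable Q (fun w => l2norm (y_err k s w)).
  pose Y w := Num.min (l2norm (y_err k s w)) (kd * l2norm (g_err k s w)).
  have mY : measurable_fun setT Y.
    by apply: measurable_minr => //; exact: rintegrable_meas (rintegrableZ kd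
      iW).
  apply: (@rintegrable_ae _ _ _ Q Y) => //.
    apply: rintegrable_le (rintegrableZ kd iW) _ => // w.
    by rewrite ger0_norm ?le_min ?l2norm_ge0 ?mulr_ge0 ?ge_min ?lexx ?orbT//
      ?l2norm_ge0// ltW.
  by apply: filterS le => w le; rewrite /Y min_l.
rewrite -[X in fun=> X]addr0.
apply: (condexp_le_of_variance (h := fun=> 0)) => //.
- exact: ltW.
- by apply: (sigma_measurableP Ggen _).2; exact: measurable_cst.
- exact: rintegrable_cst.
- by apply: filterS le => w; rewrite addr0.
Qed.

End LocalError.

End Process.

Theorem corollary4p13 (R : realType) (L Gam taumin kl kH zeta sigma : R)
  (b : nat)
  (hL : 0 <= L) (hGam : 0 <= Gam) (htaumin : 0 < taumin) (hkl : 0 < kl)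
  (hkH : 0 < kH) (hzeta : 0 < zeta) (hsigma : 0 < sigma < 1) (hb : (0 < b)%N) :
  exists mu0 nu0 : R, (0 < mu0 <= 1) /\ (0 < nu0 < 1) /\
  forall (gamma : R) (N n m S : nat)
    (X : set 'cV[R]_n) (f : 'I_N -> 'cV[R]_n -> R) (c : 'cV[R]_n -> 'cV[R]_m)
    (gam : 'I_m -> R)
    (d : measure_display) (T : measurableType d) (P : probability T R)
    (p : sqp_process R T n m N)
    (x0 : 'cV[R]_n) (tau0 eps alpha z : R) (kbar : nat)
    (mE : measurable (merit_event f c S p sigma kbar taumin))
    (lam Lam : nat -> R),
  let E := merit_event f c S p sigma kbar taumin in
  let Q := cond_prob P mE in
  let A := taumin * L + Gam in
  let phi := fun x => merit f c x taumin in
  let phi_inf := inf [set phi x | x in X] in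
  let residual := fun (k : nat) (w : T) =>
    \sum_(kbar <= j < k.+1) \sum_(s < S)
      (l2norm (g_at f p j s w + (J_at c p j s w)^T *m ytrue p j s w) ^+ 2
         / kH ^+ 2
       + l2norm (c_at c p j s w)) in
  0 < gamma <= 1 -> (b < N)%N -> b%:R < N%:R `^ gamma -> (0 < S)%N ->
  0 < tau0 -> 0 < eps < 1 ->
  smooth_problem X f c L gam -> \sum_(i < m) gam i = Gam ->
  has_lbound [set phi x | x in X] ->
  random_process S p ->
  sqp_run f c b S p x0 tau0 eps sigma alpha ->
  (forall k s w, (s <= S)%N -> X (itr p k s w)) ->
  deterministic_counterpart f c S p ->
  hess_assumption c S p kH zeta ->
  (0 < P E)%E ->
  gradient_estimates f b S p Q L ->
  model_reduction_bound f c b S p E kl ->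
  alpha = mu0 * b%:R / (A * N%:R `^ gamma) -> 0 < alpha <= 1 ->
  z = A / N%:R `^ (gamma / 2) ->
  S%:Z <= Num.floor (N%:R `^ (3 * gamma / 2) /
            (mu0 * (b%:R + L ^+ 2 / (A ^+ 2 * kl * zeta)))) ->
  lam S = 0 ->
  (forall s, (s < S)%N -> lam s =
     lam s.+1 * (alpha ^+ 2 * L ^+ 2 / (kl * b%:R * zeta) + alpha * z + 1)
     + alpha ^+ 2 * A * L ^+ 2 / (2 * kl * b%:R * zeta)) ->
  (forall s, (s < S)%N -> Lam s =
     alpha - alpha ^+ 2 * A / (2 * taumin * kl)
     - lam s.+1 * (alpha / (taumin * kl)) * (alpha + z^-1)) ->
  [/\ nu0 * b%:R / (A * N%:R `^ gamma)
        <= \big[Num.min/Lam 0%N]_(s < S) Lam s,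
      forall k, (kbar <= k)%N ->
        ('E_Q[(fun w => ((k - kbar + 1)%N%:R * S%:R)^-1 * residual k w)%R]
         <= (A * N%:R `^ gamma)%:E
              * ('E_Q[(fun w => phi (itr p kbar 0%N w))%R] - phi_inf%:E)
              * (((k - kbar + 1)%N%:R * S%:R * nu0 * b%:R)^-1)%:E)%E &
      forall (k s : nat) (xs : 'cV[R]_n) (ys : 'cV[R]_m)
        (dx dx0 dc kd : R),
      let D := [set w : T | [/\ l2norm (itr p k s w - xs) <= dx,
                 l2norm (itr p k 0%N w - xs) <= dx0 &
                 l2norm (c_at c p k s w) <= dc]] in
      let dy := dc + L * (dx0 + dx) / Num.sqrt b%:R + L * dx in
      (s < S)%N -> stationary f c xs ys ->
      0 < dx -> 0 < dx0 -> 0 < dc -> 0 < kd ->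
      (forall w, E w -> opnorm2 (invmx (K_at c p k s w)) <= kd) ->
      condexp_le_on Q (sigma_ks p k s) D
        (fun w => l2norm (col_mx (gbar f b p k s w - grad (favg f) xs)
                                 (c_at c p k s w)))
        (fun=> dy) /\
      condexp_le_on Q (sigma_ks p k s) D
        (fun w => l2norm (ybar p k s w - ytrue p k s w))
        (fun=> kd * dy + 2 * kd ^+ 2 * Gam * dx * l2norm (grad (favg f) xs))].
Proof.
pose mu := step_coeff taumin kl b.
pose C : R := (kl * taumin)^-1 + sigma^-1.
have sg0 : 0 < sigma by case/andP: hsigma.
have mu0 : 0 < mu := step_coeff_gt0 htaumin hkl hb.
have mu1 : mu <= 1 := step_coeff_le1 taumin kl b.
have C0 : 0 < C by rewrite addr_gt0 ?invr_gt0 ?mulr_gt0.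
have C1 : 0 < 1 + C by rewrite addr_gt0.
(* mu / 2 comes from the lower bound on [Lam], and C is the price of the residual in terms of the
   reduction. Dividing by 1 + C instead of C keeps the quotient below 1 and below mu / 2, so one
   constant serves both claims. *)
exists mu, (mu / 2 / (1 + C)); split; first by rewrite mu0.
split.
  by rewrite divr_gt0 ?divr_gt0//= ltr_pdivrMr// mul1r; lra.
set nu := mu / 2 / (1 + C).
have nu0 : 0 < nu by rewrite !divr_gt0.
have muE : mu / 2 = nu * (1 + C) by rewrite divfK// gt_eqF.
move=> gamma N n m S X f c gam d T P p x0 tau0 eps alpha z kbar mE lam Lam.
move=> E Q A phi phi_inf residual gamma01 bN bM S0 tau00 eps01 sp gamE lb rp
  run.
move=> itrX det ha PE ge mrb alphaE alpha01 zE Sle lamS lamE LamE.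
have N0 : (0 < N)%N by exact: leq_trans bN.
have NR : 0 < N%:R :> R by rewrite ltr0n.
set M := N%:R `^ gamma in bM alphaE Sle zE *.
have M0 : 0 < M by exact: powR_gt0.
have rE : N%:R `^ (gamma / 2) = Num.sqrt M.
  have -> : M = (N%:R `^ (gamma / 2)) ^+ 2.
    rewrite expr2 -powRD ?(gt_eqF NR) ?implybT//.
    by congr (_ `^ _); field.
  by rewrite sqrtr_sqr ger0_norm// powR_ge0.
have MrE : N%:R `^ (3 * gamma / 2) = M * Num.sqrt M.
  rewrite -rE -powRD ?(gt_eqF NR) ?implybT//.
  by congr (_ `^ _); field.
have A_ge0 : 0 <= A by rewrite addr_ge0 ?mulr_ge0 ?(ltW htaumin).
(* If A were 0, the convention that 0 has inverse 0 would make [alpha] vanish. *)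
have A0 : 0 < A.
  rewrite lt_def A_ge0 andbT; apply/eqP => A_eq0.
  by move: alpha01; rewrite alphaE A_eq0 mul0r invr0 mulr0 ltxx.
have z0 : 0 < z by rewrite zE divr_gt0// powR_gt0.
have SR : S%:R <= M * Num.sqrt M /
    (mu * (b%:R + L ^+ 2 / (A ^+ 2 * kl * zeta))).
  by move: Sle; rewrite floor_ge_int MrE.
rewrite rE in zE.
have [lam0 rLam] := lyapunov_coeff_bound htaumin hkl hzeta hb A0 bM alphaE zE SR
  lamS lamE LamE.
set r := step_coeff taumin kl b / 2 * b%:R / (A * M) in rLam.
have bR : 0 < b%:R :> R by rewrite ltr0n.
have rE' : r = nu * (1 + C) * b%:R / (A * M) by rewrite /r -/mu muE.
have r0 : 0 < r by rewrite rE' !(divr_gt0, mulr_gt0).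
split.
- have le : nu * b%:R / (A * M) <= r.
    rewrite rE' ler_wpM2r ?invr_ge0 ?mulr_ge0 ?(ltW M0)// ler_wpM2r//.
    by rewrite ler_peMr ?(ltW nu0)// lerDl ltW.
  (* The default value [Lam 0] of the minimum is one of its terms, since S > 0. *)
  elim/big_ind: _ => [|x y lex ley|s _].
  + exact: le_trans (rLam _ S0).
  + by rewrite le_min lex ley.
  + exact: le_trans (rLam _ (ltn_ord s)).
- move=> k kk.
  have [ires mres] := mean_residual_le htaumin hkl hkH hsigma sp rp itrX det ha
    PE ge mrb kk.
  have dec := tail_decrease hL htaumin hkl hzeta hb N0 sp gamE rp run itrX det
    ha
    PE ge mrb alpha01 z0 A_ge0 lam0 lamS lamE LamE kk rLam.
  have iphi j : rintegrable Q (fun w => phi (itr p j 0%N w)).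
    exact/essbounded_integrable/(essbounded_merit mE sp rp itrX PE j (leq0n S)).
  set F := mean _ _ in dec; set F' := mean _ _ in dec; set D := \sum_(_ <= _ <
    _) _ in mres dec.
  have infF : phi_inf <= F'.
    rewrite -(mean_cst Q phi_inf); apply: mean_le; [exact:
      rintegrable_cst|exact: iphi|].
    apply: aeW => w; apply: (ge_inf lb); exists (itr p k.+1 0%N w) => //.
    exact: itrX.
  have meanE (Y : T -> R) : rintegrable Q Y -> ('E_Q[Y] = (mean Q Y)%:E)%E.
    by move=> iY; rewrite unlock /mean /Rintegral fineK//; exact:
      integrable_fin_num.
  rewrite (meanE _ (rintegrableZ _ ires)) (meanE _ (iphi kbar)) (meanZ _ ires)
    -/F.
  rewrite -EFinB -!EFinM lee_fin.
  set K := (k - kbar + 1)%N%:R.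
  have K0 : 0 < K :> R by rewrite ltr0n addn1.
  have S0R : 0 < S%:R :> R by rewrite ltr0n.
  (* In terms of the rate [r] the definition of [nu] leaves exactly a factor 1 + C, against which
     the C of the residual bound is compared. *)
  have -> : A * M * (F - phi_inf) * (K * S%:R * nu * b%:R)^-1 =
      (K * S%:R)^-1 * ((1 + C) * ((F - phi_inf) / r)).
    by rewrite rE'; field; rewrite ?gt_eqF.
  rewrite ler_wpM2l ?invr_ge0 ?mulr_ge0//.
  rewrite (le_trans mres)//.
  have Dle : D <= (F - phi_inf) / r.
    by rewrite ler_pdivlMr// mulrC (le_trans dec)// lerD2l lerN2.
  (* Nonnegativity allows C to be enlarged to 1 + C; it follows from the sum [D] of mean reductions
     being nonnegative. *)
  have D0 : 0 <= (F - phi_inf) / r.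
    apply: le_trans Dle; rewrite /D big_seq; apply: sumr_ge0 => j.
    rewrite mem_index_iota => /andP[kj _]; apply: sumr_ge0 => s _.
    exact: (reduction_mean_ge0 htaumin hkl sp rp itrX PE ge mrb kj (ltn_ord s)).
  rewrite -/C (le_trans (ler_wpM2l (ltW C0) Dle))// ler_wpM2r// lerDr ler01//.
- move=> k s xs ys dx dx0 dc kd D dy sS _ hdx hdx0 hdc hkd Kle; split.
    exact: (condexp_rhs_error_le hL N0 sp rp itrX PE ge k sS xs dc hdx hdx0).
  have [V [cV Vle]] := condexp_multiplier_error_le hL hzeta sp rp run itrX det
    ha
    PE ge sS xs dc hdx hdx0 hkd Kle.
  (* The same version serves: the other terms of the bound are nonnegative additions to
     [kd * beta]. *)
  exists V; split=> //; apply: filterS Vle => w Vle /Vle /le_trans; apply.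
  rewrite /dy; set beta := L * _ / _; set e := _ * l2norm _.
  have -> : kd * (dc + beta + L * dx) + e = kd * beta + (kd * (dc + L * dx) +
    e).
    by ring.
  rewrite lerDl addr_ge0//.
    by rewrite mulr_ge0 ?(ltW hkd)// addr_ge0 ?(ltW hdc)// mulr_ge0// ltW.
  by rewrite !mulr_ge0 ?l2norm_ge0 ?exprn_ge0// ltW.
Qed.
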